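(* Let $T\sim\{X_n\}_{n=1}^\infty$ be a random weighted shift, $\Gamma=\operatorname{essran}X_1$, and let $A$ be a (deterministic) bilateral weighted shift with nonnegative weights. Then: (i) $\mathbb P(A\lhd T)=1$ if $\Sigma_1(A)\subset\Gamma$, and $\mathbb P(A\lhd T)=0$ if $\Sigma_1(A)\nsubseteq\Gamma$. (ii) If $0\notin\Gamma$, then $T\lhd A$ a.s. if and only if $\{0\}\times\Gamma^n\subset\Sigma_{n+1}(A)$ for all $n\ge1$. (iii) If $0$ is an accumulation point of $\Gamma$, then $T\lhd A$ a.s. if and only if $\Gamma^n\subset\Sigma_n(A)$ for all $n\ge1$. (iv) If $0$ is an isolated point of $\Gamma$, then $T\lhd A$ a.s. if and only if $\{0\}\times\Gamma_1^n\times\{0\}\subset\Sigma_{n+2}(A)$ for all $n\ge0$, where $\Gamma_1=\Gamma\setminus\{0\}$.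
   Context: $\mathcal H$ is a complex separable infinite-dimensional Hilbert space with orthonormal basis $\{e_n\}_{n=1}^\infty$. $\{X_n\}_{n=1}^\infty$ are nonnegative, bounded, i.i.d. random variables on a probability space $(\Omega,\mathcal F,\mathbb P)$. Writing $T\sim\{X_n\}$ means that $T=T(\omega)$ is the random unilateral weighted shift $T(\omega)e_n=X_n(\omega)e_{n+1}$, $n\ge1$. $\operatorname{essran}X_1$ is the essential range of $X_1$ (closed support of its law). A bilateral weighted shift $A$ acts by $Af_i=\lambda_if_{i+1}$ ($i\in\mathbb Z$) on an orthonormal basis $\{f_i\}_{i\in\mathbb Z}$ of a Hilbert space, with bounded weights $\{\lambda_i\}$. Its $n$-spectrum ($n\ge1$) is $$\Sigma_n(A)=\text{closure in }\mathbb R^n\text{ of }\{(|\lambda_{i+1}|,\dots,|\lambda_{i+n}|):i\in\mathbb Z\}.$$ For $n=0$, $\{0\}\times\Gamma_1^0\times\{0\}=\{(0,0)\}$. For Hilbert space operators $A,B$, $A\lhd B$ means $\|p(A,A^* )\|\le\|p(B,B^* )\|$ for all complex polynomials $p(x,y)$ in two free (noncommuting) variables (constant terms allowed). *)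

(* Defs.v *)
From HB Require Import structures.
From mathcomp Require Import all_boot all_order all_algebra.
From mathcomp Require Import complex.
From mathcomp Require Import(canonicals, coercions) finmap monalg.
From mathcomp Require Import all_classical all_reals all_analysis.

Set Implicit Arguments.
Unset Strict Implicit.
Unset Printing Implicit Defensive.

Import Order.TTheory GRing.Theory Num.Theory.
Import numFieldNormedType.Exports.

Local Open Scope classical_set_scope.
Local Open Scope ring_scope.

(* The inner product is linear in the first variable. *)
HB.mixin Record CompleteNormedModule_isHilbert (R : realType) H
    of CompleteNormedModule R[i] H := {
  inner : {dot H for (@Num.conj R[i])} ;
  inner_norm : forall x : H, inner x x = `|x| ^+ 2
}.

#[short(type="hilbertType")]
HB.structure Definition Hilbert (R : realType) :=
  {H of CompleteNormedModule_isHilbert R H & CompleteNormedModule R[i] H}.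

Section hilbert_operators.
Context {R : realType}.
Implicit Types H K : hilbertType R.

Definition linear_span H (I : Type) (e : I -> H) : set H :=
  [set x | exists (s : seq I) (c : I -> R[i]), x = \sum_(i <- s) c i *: e i].

Definition orthonormal_basis H (I : eqType) (e : I -> H) : Prop :=
  (forall i j, inner (e i) (e j) = (i == j)%:R) /\
  closure (linear_span e) = setT.

(* For a bounded [B] the vector [z] below exists and is unique, by Riesz. *)
Definition adjoint H (B : H -> H) : H -> H :=
  fun y => xget 0 [set z | forall x, inner (B x) y = inner x z].

(* [normedModType R[i]] has its norm in [R[i]]; [complex.Re] brings it to [R]. *)
Definition opnorm H (B : H -> H) : \bar R :=
  ereal_sup [set (complex.Re `|B x|)%:E | x in [set x : H | `|x| <= 1]].

(* The algebra of the free monoid on two letters: [false] is the variable x,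
   [true] is the variable y. *)
Definition free_poly : Type := monalg.malg (monalg.fmonom bool) R[i].

Definition word_eval H (B1 B2 : H -> H) (m : seq bool) (v : H) : H :=
  foldr (fun b u => if b then B2 u else B1 u) v m.

Definition free_poly_eval H (p : free_poly) (B1 B2 : H -> H) (v : H) : H :=
  \sum_(m <- monalg.msupp p) monalg.mcoeff m p *: word_eval B1 B2 m v.

Definition lhd K H (A : K -> K) (B : H -> H) : Prop :=
  forall p : free_poly,
    (opnorm (free_poly_eval p A (adjoint A)) <=
     opnorm (free_poly_eval p B (adjoint B)))%E.

Definition unilateral_shift H (e : nat -> H) (w : nat -> R)
    (B : {linear H -> H}) : Prop :=
  continuous B /\ forall n, B (e n) = (w n)%:C%C *: e n.+1.

Definition bilateral_shift H (f : int -> H) (w : int -> R)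
    (B : {linear H -> H}) : Prop :=
  [/\ continuous B,
      exists M, forall i, `|w i| <= M &
      forall i, B (f i) = (w i)%:C%C *: f (i + 1)].

Definition cartesian_power (G : set R) (n : nat) : set 'rV[R]_n :=
  [set u | forall i, G (u 0 i)].

Definition n_spectrum (w : int -> R) (n : nat) : set 'rV[R]_n :=
  closure [set \row_(j < n) `|w (i + j.+1%:Z)| | i in [set: int]].

End hilbert_operators.

Arguments cartesian_power {R} G n.
Arguments n_spectrum {R} w n.

Notation "A ◁ B" := (lhd A B) (at level 70, no associativity).

Section random_variables.
Context {d : measure_display} {Omega : measurableType d} {R : realType}.
Variable P : probability Omega R.

Definition mutually_independent (X : nat -> {RV P >-> R}) : Prop :=
  forall (s : seq nat) (B : nat -> set R), uniq s ->
    (forall n, measurable (B n)) ->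
    P (\bigcap_(n in [set` s]) X n @^-1` B n) =
      (\prod_(n <- s) P (X n @^-1` B n))%E.

Definition identically_distributed (X : nat -> {RV P >-> R}) : Prop :=
  forall m n (B : set R), measurable B ->
    distribution P (X m) B = distribution P (X n) B.

Definition iid (X : nat -> {RV P >-> R}) : Prop :=
  mutually_independent X /\ identically_distributed X.

(* closed support of the law of [X] *)
Definition essran (X : {RV P >-> R}) : set R :=
  [set x | forall U : set R, open U -> U x -> (0 < distribution P X U)%E].

End random_variables.

(* Main.v *)
Require Import Defs.
From HB Require Import structures.
From mathcomp Require Import all_boot all_order all_algebra.
From mathcomp Require Import complex.
From mathcomp Require Import(canonicals, coercions) finmap monalg.
From mathcomp Require Import all_classical all_reals all_analysis.
From mathcomp Require Import zify ring lra.

Set Implicit Arguments.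
Unset Strict Implicit.
Unset Printing Implicit Defensive.

Import Order.TTheory GRing.Theory Num.Theory.
Import numFieldNormedType.Exports.

Local Open Scope classical_set_scope.
Local Open Scope ring_scope.

(** Word weights. A word in a weighted shift S and its adjoint sends the basis
    vector e_k to a multiple of a basis vector, and the factor, the weight of
    the word at k, is a product of weights of S near k. Consequently
    |q(S, S') e_k|^2, for a polynomial q in S and its adjoint S', is a quadratic
    form in the weights of the words of q at k ([hnorm_local_vector]).

    Local criterion. For weighted shifts S and B the relation S ◁ B holds exactly
    when each basis vector of S is approximated by basis vectors of B, in the
    sense of [locally_approximable]: on every finite set of words the weights at
    the former are limits of weights at the latter.
    - The condition suffices ([lhd_of_approximable]). The vectors q(S, S') e_k
      satisfy the estimate of p(S, S') by the norm of p(B, B'), as their norms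
      are limits of norms in the space of B. A finitely supported vector is a
      sum of such vectors over the blocks between consecutive zero weights; the
      blocks are orthogonal and reduce S, so Pythagoras concludes.
    - The condition is necessary ([approximable_of_lhd]). For a word m the
      operator m' m is diagonal, with the squared weights of m as eigenvalues.
      If the weights at e_k are not approximated, then
      c - sum_m (m' m - a_m)^2, centred at the squared weights a_m at k, has
      eigenvalue c at k, whereas its norm for B is less than c.

    Windows. Word weights of length n at k depend on the weights at distance at
    most n from k, and nothing beyond a zero weight matters
    ([word_weight_close]). Conversely, the weights following k are quotients of
    weights of powers of the shift, up to the first zero
    ([window_of_approximable]). So the criterion compares windows of weights
    that are cut at their zeros.

    Probability. Almost surely every X_n lies in Gamma ([ae_essran]), and each
    finite pattern of sets charged by the law of X_1 occurs
    ([pattern_recurrence]). If Sigma_1(A) lies in Gamma, each window of A is such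
    a pattern up to any precision, so A ◁ T almost surely; a weight of A outside
    Gamma is not approximated by any X_n in Gamma, so A ◁ T fails almost surely.
    The criterion has countably many quantifiers, which makes the event A ◁ T
    measurable. For T ◁ A, the first basis vector of T sees the window
    (0, X_1, ..., X_n), which is close to (0, g_1, ..., g_n) with positive
    probability for any g_1, ..., g_n in Gamma; so all these windows up to their
    first interior zero must be windows of A in the limit. What is left is
    bookkeeping about zeros. If 0 is not in Gamma only the left end is a zero. If
    0 is an accumulation point, zeros can be replaced by small positive weights
    and a window starting with 0 is itself in a power of Gamma. If 0 is
    isolated, it is an atom of the law, zeros recur, and T is a direct sum of
    finite blocks whose windows start and end with 0. *)

(** * Hilbert space preliminaries *)

Section hilbert_preliminaries.
Context {R : realType}.
Implicit Types H : hilbertType R.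

(** The norm takes its values in R[i]; its real part carries the same information
    in a totally ordered field, where the estimates are made. *)
Definition hnorm H (x : H) : R := complex.Re `|x|.

Lemma normr_normc (a : R[i]) : `|a| = (Normc.normc a)%:C%C.
Proof. by []. Qed.

Lemma normc_ge0 (a : R[i]) : 0 <= Normc.normc a.
Proof. by rewrite -lecR -normr_normc normr_ge0. Qed.

Lemma normc_real (a : R) : 0 <= a -> Normc.normc a%:C%C = a.
Proof.
by move=> a0; apply: complexI; rewrite -normr_normc ger0_norm // ler0c.
Qed.

Lemma eq_of_normcB_le (a b : R[i]) :
  (forall eps, 0 < eps -> Normc.normc (a - b) <= eps) -> a = b.
Proof.
move=> ab; apply/eqP; rewrite -subr_eq0 -normr_eq0 normr_normc.
apply/eqP; congr (_%:C%C); apply/eqP; rewrite eq_le normc_ge0 andbT.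
by apply/ler_addgt0Pr => eps eps0; rewrite add0r ab.
Qed.

Lemma hnormE H (x : H) : `|x| = (hnorm x)%:C%C.
Proof. by rewrite /hnorm RRe_real // ger0_real. Qed.

Lemma hnorm_ge0 H (x : H) : 0 <= hnorm x.
Proof. by rewrite -lecR -hnormE normr_ge0. Qed.

Lemma hnormD H (x y : H) : hnorm (x + y) <= hnorm x + hnorm y.
Proof. by rewrite -lecR rmorphD /= -!hnormE ler_normD. Qed.

Lemma hnormZ H (a : R[i]) (x : H) : hnorm (a *: x) = Normc.normc a * hnorm x.
Proof. by apply: complexI; rewrite rmorphM /= -!hnormE normrZ. Qed.

Lemma hnormB H (x y : H) : hnorm (x - y) = hnorm (y - x).
Proof. by rewrite /hnorm distrC. Qed.

Lemma hnorm_eq0 H (x : H) : hnorm x = 0 -> x = 0.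
Proof. by move=> x0; apply/eqP; rewrite -normr_eq0 hnormE x0. Qed.

Lemma hnorm0 H : hnorm (0 : H) = 0.
Proof. by rewrite /hnorm normr0. Qed.

Lemma inner_hnorm H (x : H) : inner x x = (hnorm x ^+ 2)%:C%C.
Proof. by rewrite inner_norm hnormE rmorphXn. Qed.

Lemma innerZl H a (x y : H) : inner (a *: x) y = a * inner x y.
Proof. by rewrite linearZl_LR. Qed.

Lemma innerZr H a (x y : H) : inner x (a *: y) = a^*%C * inner x y.
Proof. by rewrite linearZr_LR. Qed.

Lemma inner_suml H (I : Type) (s : seq I) (F : I -> H) (y : H) :
  inner (\sum_(i <- s) F i) y = \sum_(i <- s) inner (F i) y.
Proof. exact: linear_sumlz. Qed.

Lemma inner_sumr H (I : Type) (s : seq I) (F : I -> H) (x : H) :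
  inner x (\sum_(i <- s) F i) = \sum_(i <- s) inner x (F i).
Proof. exact: linear_sumr. Qed.

Lemma inner_pythagoras H (x y : H) : inner x y = 0 ->
  inner (x + y) (x + y) = inner x x + inner y y.
Proof. exact: hnormDd. Qed.

Lemma cauchy_schwarz H (x y : H) :
  Normc.normc (inner x y) <= hnorm x * hnorm y.
Proof.
have [->|y0] := eqVneq y 0.
  by rewrite linear0r Normc.normc0 mulr_ge0 ?hnorm_ge0.
have yy0 : inner y y != 0.
  by rewrite inner_norm expf_neq0 // normr_eq0.
pose a := inner x y / inner y y; pose u := x - a *: y.
have uy : inner u (a *: y) = 0.
  by rewrite innerZr linearBl /= innerZl divfK // subrr mulr0.
have xE : x = u + a *: y by rewrite subrK.
have := inner_pythagoras uy; rewrite -xE => xx.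
have : inner (a *: y) (a *: y) <= inner x x.
  by rewrite xx lerDr inner_norm exprn_ge0.
rewrite !inner_norm normrZ exprMn normrM normfV.
rewrite !hnormE normr_normc.
rewrite ger0_norm ?dnorm_ge0 // inner_hnorm.
have hy0 : 0 < hnorm y.
  by rewrite -ltcR -hnormE normr_gt0.
rewrite -!(rmorphXn, rmorphM, fmorphV) /= lecR => h.
rewrite -(@ler_pXn2r _ 2) ?nnegrE ?mulr_ge0 ?hnorm_ge0 //; last first.
  exact: normc_ge0.
rewrite exprMn -ler_pdivrMr ?exprn_gt0 //.
apply: le_trans h; rewrite le_eqVlt; apply/orP; left; apply/eqP.
by field; rewrite gt_eqF.
Qed.

Lemma hnorm_sum_orthogonal H (I : eqType) (s : seq I) (y : I -> H) :
  uniq s -> {in s &, forall i j, i != j -> inner (y i) (y j) = 0} ->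
  hnorm (\sum_(i <- s) y i) ^+ 2 = \sum_(i <- s) hnorm (y i) ^+ 2.
Proof.
elim: s => [|i s IHs]; first by rewrite !big_nil hnorm0 expr0n.
move=> /= /andP[si us] yo; rewrite !big_cons -IHs //; last first.
  by move=> j k js ks; apply: yo; rewrite inE ?js ?ks orbT.
apply: complexI; rewrite rmorphD /= -!inner_hnorm; apply: inner_pythagoras.
rewrite inner_sumr big_seq big1 // => j js; apply: yo.
- by rewrite mem_head.
- by rewrite inE js orbT.
by apply: contraNneq si => ->.
Qed.

Lemma closure_hnorm H (D : set H) (x : H) (eps : R) :
  closure D = setT -> 0 < eps -> exists2 y, D y & hnorm (x - y) < eps.
Proof.
move=> clD eps0; have : closure D x by rewrite clD.
move=> /(_ [set y | `|x - y| < eps%:C%C]) []; last first.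
  by move=> y [Dy /=]; rewrite hnormE ltcR; exists y.
by apply/nbhs_normP; exists eps%:C%C => //=; rewrite ltcR.
Qed.

(** Linearity and boundedness of a bare function: the polynomials in an operator
    and its adjoint are functions without a bundled linear structure. *)
Definition bounded_operator H (B : H -> H) : Prop :=
  linear B /\ exists2 M : R, 0 <= M & forall x, hnorm (B x) <= M * hnorm x.

Lemma bounded_operator_linear H (B : {linear H -> H}) :
  continuous B -> bounded_operator B.
Proof.
move=> cB; split; first exact: linearP.
have /linear_bounded_continuous/linear_boundedP := cB.
move=> /pinfty_ex_gt0 [M M0 hM].
have ME : M = (complex.Re M)%:C%C by rewrite RRe_real // gtr0_real.
exists (complex.Re M); first by rewrite -lecR -ME ltW.
by move=> x; rewrite -lecR rmorphM /= -ME -!hnormE.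
Qed.

Lemma bounded_operator_dense H (B : H -> H) (D : set H) (c : R) :
  bounded_operator B -> closure D = setT -> 0 <= c ->
  (forall x, D x -> hnorm (B x) <= c * hnorm x) ->
  forall x, hnorm (B x) <= c * hnorm x.
Proof.
move=> [linB [M M0 BM]] clD c0 hD x; apply/ler_addgt0Pr => e e0.
have d0 : 0 < e / (M + c + 1) by rewrite divr_gt0 // ltr_wpDl // addr_ge0.
have [y Dy xy] := closure_hnorm x clD d0.
have -> : B x = B y + B (x - y).
  rewrite -[in LHS](subrK y x) -[x - y]scale1r linB scale1r [RHS]addrC.
  by rewrite scale1r.
have yx : hnorm y <= hnorm x + hnorm (x - y).
  rewrite hnormB; have := hnormD x (y - x); rewrite addrC subrK => h.
  exact: h.
have cy := ler_wpM2l c0 yx.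
have te : hnorm (x - y) * (M + c + 1) <= e.
  by rewrite -ler_pdivlMr ?ltW // ltr_wpDl // addr_ge0.
have t0 := hnorm_ge0 (x - y).
apply: le_trans (hnormD _ _) _.
apply: le_trans (lerD (hD _ Dy) (BM _)) _; lra.
Qed.

End hilbert_preliminaries.

Section adjoints.
Context {R : realType} {H : hilbertType R}.
Implicit Types (B : H -> H) (x y z : H).

Lemma inner_inj y z : (forall x, inner x y = inner x z) -> y = z.
Proof.
move=> yz; apply/eqP; rewrite -subr_eq0; apply/eqP/hnorm_eq0/eqP.
rewrite -sqrf_eq0; apply/eqP/complexI; rewrite -inner_hnorm.
by rewrite linearBr /= yz subrr.
Qed.

Lemma linear_span_linear (I : Type) (e : I -> H) (Q : H -> Prop) :
  Q 0 -> (forall a x y, Q x -> Q y -> Q (a *: x + y)) ->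
  (forall i, Q (e i)) -> linear_span e `<=` Q.
Proof.
move=> Q0 QD Qe _ [s [c ->]]; elim: s => [|i s IHs]; first by rewrite big_nil.
by rewrite big_cons; apply: QD.
Qed.

(** A bound for [B] bounds the representing vector as well, because
    |z|^2 = <z, z> = <B z, y>. *)
Lemma riesz_bound B (M : R) y z :
  0 <= M -> (forall x, hnorm (B x) <= M * hnorm x) ->
  (forall x, inner (B x) y = inner x z) -> hnorm z <= M * hnorm y.
Proof.
move=> M0 BM zP; have [z0|z0] := eqVneq (hnorm z) 0.
  by rewrite z0 mulr_ge0 ?hnorm_ge0.
have zpos : 0 < hnorm z by rewrite lt_def z0 hnorm_ge0.
rewrite -(ler_pM2l zpos) -expr2.
have -> : hnorm z ^+ 2 = Normc.normc (inner (B z) y).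
  by rewrite zP inner_hnorm normc_real // exprn_ge0 // hnorm_ge0.
apply: le_trans (cauchy_schwarz _ _) _.
rewrite mulrCA mulrA ler_wpM2r ?hnorm_ge0 //.
Qed.

(** The vectors y for which x |-> <B x, y> is represented form a subspace, and
    this subspace is closed, because the representing vector depends boundedly
    on y. It is the whole space as soon as it contains a total family. For a
    shift the representing vectors of a basis are explicit, so that its adjoint
    exists without an appeal to the Riesz theorem. *)
Lemma representable_total B (I : Type) (e : I -> H) :
  bounded_operator B -> closure (linear_span e) = setT ->
  (forall i, exists z, forall x, inner (B x) (e i) = inner x z) ->
  forall y, exists z, forall x, inner (B x) y = inner x z.
Proof.
move=> [linB [M M0 BM]] clE He y.
have span_rep v : linear_span e v ->
    exists z, forall x, inner (B x) v = inner x z.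
  move: v; apply: linear_span_linear => //.
    by exists 0 => x; rewrite !linear0r.
  move=> a v v' [z zP] [z' z'P]; exists (a *: z + z') => x.
  by rewrite !linearDr /= !innerZr zP z'P.
have approx (n : nat) : exists vz : H * H,
    hnorm (y - vz.1) < n.+1%:R^-1 /\
    forall x, inner (B x) vz.1 = inner x vz.2.
  have n0 : 0 < n.+1%:R^-1 :> R by rewrite invr_gt0.
  have [v ev yv] := closure_hnorm y clE n0.
  by have [z zP] := span_rep v ev; exists (v, z).
have [vz vzP] := choice approx.
pose v n := (vz n).1; pose z n := (vz n).2.
have vy n : hnorm (y - v n) < n.+1%:R^-1 by exact: (vzP n).1.
have zP n x : inner (B x) (v n) = inner x (z n) by exact: (vzP n).2.
have zz m n : hnorm (z m - z n) <= M * (m.+1%:R^-1 + n.+1%:R^-1).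
  have /riesz_bound h : forall x, inner (B x) (v m - v n) = inner x (z m - z n).
    by move=> x; rewrite !linearBr /= !zP.
  apply: le_trans (h _ M0 BM) _; apply: ler_wpM2l => //.
  rewrite -(subrKA y); apply: le_trans (hnormD _ _) _.
  by rewrite hnormB; apply: lerD; exact/ltW/vy.
have cz : cvgn z.
  apply/cauchy_cvgP/cauchy_ballP => d dpos.
  have ee : d = (complex.Re d)%:C%C.
    by rewrite RRe_real // gtr0_real.
  have e0 : 0 < complex.Re d by move: dpos; rewrite {1}ee ltcR.
  have d0 : 0 < complex.Re d / (M + M + 1).
    by rewrite divr_gt0 // ltr_wpDl // addr_ge0.
  have [N _ hN] := near_infty_natSinv_lt (PosNum d0).
  exists (z @` [set n | (N <= n)%N], z @` [set n | (N <= n)%N]) => /=.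
    by split; exists N => // n Nn; exists n.
  move=> [_ _] /= [[m Nm <-] [n Nn <-]]; rewrite -ball_normE /= hnormE ee ltcR.
  apply: le_lt_trans (zz _ _) _.
  have /= := hN _ Nm; have /= := hN _ Nn; rewrite !ltr_pdivlMr; try lra.
  set a := m.+1%:R^-1; set b := n.+1%:R^-1 => hb ha.
  have a0 : 0 < a by rewrite invr_gt0.
  have b0 : 0 < b by rewrite invr_gt0.
  nra.
exists (limn z) => x; apply: eq_of_normcB_le => eps e0.
have d0 : 0 < eps / (hnorm (B x) + hnorm x + 1).
  by rewrite divr_gt0 // ltr_wpDl // addr_ge0 // hnorm_ge0.
have [N _ hN] := near_infty_natSinv_lt (PosNum d0).
have : \forall n \near \oo,
    `|limn z - z n| < (eps / (hnorm (B x) + hnorm x + 1))%:C%C.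
  by move/cvgrPdist_lt : cz; apply; rewrite ltcR.
move=> [N' _ hN']; pose n := maxn N N'.
have /= h1 := hN n (leq_maxl _ _).
have := hN' n (leq_maxr _ _) => /=; rewrite hnormE ltcR => h2.
have -> : inner (B x) y - inner x (limn z) =
    inner (B x) (y - v n) + inner x (z n - limn z).
  by rewrite !linearBr /= zP addrA subrK.
rewrite -lecR -normr_normc; apply: le_trans (ler_normD _ _) _.
rewrite !normr_normc -rmorphD lecR.
apply: le_trans (lerD (cauchy_schwarz _ _) (cauchy_schwarz _ _)) _.
rewrite [hnorm (z n - _)]hnormB.
have := ltW (lt_trans (vy n) h1); move: (ltW h2).
rewrite !ler_pdivlMr; first last.
- by rewrite ltr_wpDl // addr_ge0 // hnorm_ge0.
- by rewrite ltr_wpDl // addr_ge0 // hnorm_ge0.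
have := hnorm_ge0 (B x); have := hnorm_ge0 x.
have := hnorm_ge0 (y - v n); have := hnorm_ge0 (limn z - z n).
set p := hnorm (y - v n); set q := hnorm (limn z - z n).
set b := hnorm (B x); set a := hnorm x => q0 p0 a0 b0 hq hp.
nra.
Qed.

End adjoints.

Section adjoint_operators.
Context {R : realType} {H : hilbertType R}.
Variables (B : H -> H) (I : Type) (e : I -> H).
Hypotheses (bB : bounded_operator B) (clE : closure (linear_span e) = setT).
Hypothesis repE : forall i, exists z, forall x, inner (B x) (e i) = inner x z.

Lemma adjointP x y : inner (B x) y = inner x (adjoint B y).
Proof.
rewrite /adjoint; case: xgetP => [z _ zP|noz]; first exact: zP.
by have [z zP] := representable_total bB clE repE y; case: (noz z).
Qed.

Lemma adjoint_eq y z : (forall x, inner (B x) y = inner x z) -> adjoint B y = z.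
Proof. by move=> zP; apply: inner_inj => x; rewrite -adjointP. Qed.

Lemma bounded_operator_adjoint : bounded_operator (adjoint B).
Proof.
split=> [a x y|].
  by apply: adjoint_eq => z; rewrite !linearDr /= !innerZr !adjointP.
have [_ [M M0 BM]] := bB; exists M => // y.
by apply: (riesz_bound M0 BM) => x; exact: adjointP.
Qed.

End adjoint_operators.

Section bounded_operators.
Context {R : realType} {H : hilbertType R}.
Implicit Types B C : H -> H.

Lemma bounded_operatorI : bounded_operator (@id H).
Proof. by split => //; exists 1 => // x; rewrite mul1r. Qed.

Lemma bounded_operator0 : bounded_operator (fun _ : H => 0).
Proof.
split=> [a x y|]; first by rewrite scaler0 addr0.
by exists 0 => // x; rewrite hnorm0 mul0r.
Qed.

Lemma bounded_operatorD B C : bounded_operator B -> bounded_operator C ->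
  bounded_operator (fun x => B x + C x).
Proof.
move=> [lB [M M0 BM]] [lC [N N0 CN]]; split=> [a x y|].
  by rewrite lB lC scalerDr addrACA.
exists (M + N) => [|x]; first by rewrite addr_ge0.
by rewrite mulrDl; apply: le_trans (hnormD _ _) (lerD (BM _) (CN _)).
Qed.

Lemma bounded_operatorZ c B : bounded_operator B ->
  bounded_operator (fun x => c *: B x).
Proof.
move=> [lB [M M0 BM]]; split=> [a x y|].
  by rewrite lB scalerDr !scalerA mulrC.
exists (Normc.normc c * M) => [|x]; first by rewrite mulr_ge0 ?normc_ge0.
by rewrite hnormZ -mulrA ler_wpM2l ?normc_ge0.
Qed.

Lemma bounded_operator_comp B C : bounded_operator B -> bounded_operator C ->
  bounded_operator (fun x => B (C x)).
Proof.
move=> [lB [M M0 BM]] [lC [N N0 CN]]; split=> [a x y|].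
  by rewrite lC lB.
exists (M * N) => [|x]; first by rewrite mulr_ge0.
by apply: le_trans (BM _) _; rewrite -mulrA ler_wpM2l.
Qed.

Lemma bounded_operator_sum (I : Type) (s : seq I) (F : I -> H -> H) :
  (forall i, bounded_operator (F i)) ->
  bounded_operator (fun x => \sum_(i <- s) F i x).
Proof.
move=> bF; elim: s => [|i s IHs].
  have -> : (fun x => \sum_(i <- [::]) F i x) = (fun _ => 0).
    by apply/funext => x; rewrite big_nil.
  exact: bounded_operator0.
have -> : (fun x => \sum_(j <- i :: s) F j x) =
    (fun x => F i x + \sum_(j <- s) F j x).
  by apply/funext => x; rewrite big_cons.
exact: bounded_operatorD.
Qed.

Lemma bounded_operator_word B C m : bounded_operator B -> bounded_operator C ->
  bounded_operator (word_eval B C m).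
Proof.
move=> bB bC; elim: m => [|b m IHm]; first exact: bounded_operatorI.
by case: b; apply: bounded_operator_comp.
Qed.

Lemma bounded_operator_poly p B C : bounded_operator B -> bounded_operator C ->
  bounded_operator (free_poly_eval p B C).
Proof.
move=> bB bC; apply: bounded_operator_sum => m; apply: bounded_operatorZ.
exact: bounded_operator_word.
Qed.

Lemma bounded_operator_at0 B : bounded_operator B -> B 0 = 0.
Proof.
move=> [lB _]; have := lB 1 0 0; rewrite !scale1r addr0 => h.
by apply: (addrI (B 0)); rewrite addr0; exact/esym.
Qed.

Lemma bounded_operatorMZ B a x : bounded_operator B -> B (a *: x) = a *: B x.
Proof.
by move=> bB; rewrite -[a *: x]addr0 bB.1 bounded_operator_at0 // addr0.
Qed.

Lemma bounded_operator_bigsum B (I : Type) (s : seq I) (F : I -> H) :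
  bounded_operator B -> B (\sum_(i <- s) F i) = \sum_(i <- s) B (F i).
Proof.
move=> bB; elim: s => [|i s IHs].
  by rewrite !big_nil bounded_operator_at0.
by rewrite !big_cons -IHs -[F i]scale1r bB.1 !scale1r.
Qed.

End bounded_operators.

(** * The weights of words in a weighted shift and its adjoint *)

Section word_weights.
Context {R : realType}.
Implicit Types (u v : int -> R) (m : seq bool) (k : int).

(** A word acts from its last letter to its first, as in [word_eval]; each
    letter [false] raises the index and each letter [true] lowers it. *)
Fixpoint word_shift m : int :=
  if m is b :: m' then word_shift m' + (if b then - 1 else 1) else 0.

Fixpoint word_weight u m k : R :=
  if m is b :: m' then
    word_weight u m' k * u (k + word_shift m' - (if b then 1 else 0))
  else 1.

Definition adjoint_word m : seq bool := rev (map negb m).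

Lemma word_shift_cat m1 m2 :
  word_shift (m1 ++ m2) = word_shift m2 + word_shift m1.
Proof.
by elim: m1 => [|b m1 IHm] /=; [rewrite addr0 | rewrite IHm addrA].
Qed.

Lemma word_weight_cat u m1 m2 k : word_weight u (m1 ++ m2) k =
  word_weight u m2 k * word_weight u m1 (k + word_shift m2).
Proof.
elim: m1 => [|b m1 IHm] /=; first by rewrite mulr1.
by rewrite IHm word_shift_cat mulrA addrA.
Qed.

Lemma adjoint_word_cons b m :
  adjoint_word (b :: m) = adjoint_word m ++ [:: ~~ b].
Proof. by rewrite /adjoint_word /= rev_cons -cats1. Qed.

Lemma word_shift_adjoint m : word_shift (adjoint_word m) = - word_shift m.
Proof.
elim: m => [|b m IHm]; first by rewrite /= oppr0.
by rewrite adjoint_word_cons word_shift_cat IHm /=; case: b => /=; lia.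
Qed.

Lemma word_weight_adjoint u m k :
  word_weight u (adjoint_word m) (k + word_shift m) = word_weight u m k.
Proof.
elim: m k => [|b m IHm] k //.
rewrite adjoint_word_cons word_weight_cat /= mul1r addr0 mulrC add0r.
rewrite -[in RHS]IHm; congr (word_weight _ _ _ * u _); case: b => /=; lia.
Qed.

Lemma word_weight_ge0 u m k : (forall i, 0 <= u i) -> 0 <= word_weight u m k.
Proof. by move=> u0; elim: m => [|b m IHm] //=; rewrite mulr_ge0. Qed.

Lemma word_weight_le u m k (M : R) : (forall i, 0 <= u i) ->
  (forall i, u i <= M) -> word_weight u m k <= M ^+ size m.
Proof.
move=> u0 uM; elim: m => [|b m IHm] //=.
by rewrite exprSr ler_pM // word_weight_ge0.
Qed.

End word_weights.

Section shift_models.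
Context {R : realType}.

Lemma gram_hnorm (H : hilbertType R) (E : int -> H) (J : pred int) k :
  (forall i j, inner (E i) (E j) = ((i == j) && J i)%:R) ->
  J k -> hnorm (E k) = 1.
Proof.
move=> gram Jk; have := inner_hnorm (E k).
rewrite gram eqxx Jk => /complexI/esym/eqP.
rewrite sqrf_eq1 => /orP[/eqP //|/eqP h].
by have := hnorm_ge0 (E k); rewrite h lerNr oppr0 ler10.
Qed.

(** One format for unilateral and bilateral shifts. Indexing both by the
    integers spares the case distinction at the left end: a unilateral shift
    has zero vectors and zero weights at the negative indices, so that
    [model_unshift] at -1 says that the adjoint kills the first basis vector. *)
Record shift_model (H : hilbertType R) (S S' : H -> H) (E : int -> H)
    (J : pred int) (u : int -> R) : Prop := ShiftModel {
  model_op : bounded_operator S;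
  model_adj : bounded_operator S';
  model_gram : forall i j, inner (E i) (E j) = ((i == j) && J i)%:R;
  model_total : closure (linear_span E) = setT;
  model_shift : forall k, S (E k) = (u k)%:C%C *: E (k + 1);
  model_unshift : forall k, S' (E (k + 1)) = (u k)%:C%C *: E k;
  model_ge0 : forall k, 0 <= u k;
  model_bounded : exists2 M, 1 <= M & forall k, u k <= M;
  model_domain : forall k, u k != 0 -> J k && J (k + 1)
}.

(** For basis vectors the functional x |-> <S x, E (k + 1)> is represented by
    u k E k: on the family [E] this is the Gram relation, where a nonzero u k
    forces k and k + 1 into [J], and continuity extends it to all x. *)
Lemma shift_model_adjoint (H : hilbertType R) (S : H -> H) E (J : pred int)
    (u : int -> R) :
  bounded_operator S ->
  (forall i j, inner (E i) (E j) = ((i == j) && J i)%:R) ->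
  closure (linear_span E) = setT ->
  (forall k, S (E k) = (u k)%:C%C *: E (k + 1)) ->
  (forall k, 0 <= u k) ->
  (forall k, u k != 0 -> J k && J (k + 1)) ->
  shift_model S (adjoint S) E J u.
Proof.
move=> bS gram total SE u0 uJ.
have dual k x : inner (S x) (E (k + 1)) = inner x ((u k)%:C%C *: E k).
  have span_dual : linear_span E `<=`
      [set x | inner (S x) (E (k + 1)) = inner x ((u k)%:C%C *: E k)].
    apply: linear_span_linear => [|a y z /= Py Pz|i] /=.
    - by rewrite (bounded_operator_at0 bS) !linear0l.
    - by rewrite bS.1 !linearDl /= !innerZl Py Pz.
    - rewrite SE innerZl innerZr !gram conjc_real (inj_eq (addIr 1)).
      have [->|_] := eqVneq i k; last by rewrite !mulr0.
      have [->|/uJ/andP[-> ->]] := eqVneq (u k) 0; last by [].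
      by rewrite !mul0r.
  apply: eq_of_normcB_le => eps e0; have [linS [M M0 SM]] := bS.
  pose z := (u k)%:C%C *: E k.
  have d0 : 0 < eps / (M * hnorm (E (k + 1)) + hnorm z + 1).
    by rewrite divr_gt0 // ltr_wpDl // addr_ge0 // ?mulr_ge0 ?hnorm_ge0.
  have [y Ey xy] := closure_hnorm x total d0.
  have -> : inner (S x) (E (k + 1)) - inner x z =
      inner (S (x - y)) (E (k + 1)) - inner (x - y) z.
    have -> : S (x - y) = S x - S y.
      by rewrite -scaleN1r addrC linS scaleN1r addrC.
    by rewrite !linearBl /= (span_dual _ Ey) opprB addrA subrK.
  rewrite -lecR -normr_normc; apply: le_trans (ler_normB _ _) _.
  rewrite !normr_normc -rmorphD lecR.
  apply: le_trans (lerD (cauchy_schwarz _ _) (cauchy_schwarz _ _)) _.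
  move: (ltW xy); rewrite ler_pdivlMr; last first.
    by rewrite ltr_wpDl // addr_ge0 // ?mulr_ge0 ?hnorm_ge0.
  have := hnorm_ge0 (x - y).
  have := ler_wpM2r (hnorm_ge0 (E (k + 1))) (SM (x - y)); lra.
have rep k : exists z, forall x, inner (S x) (E k) = inner x z.
  by exists ((u (k - 1))%:C%C *: E (k - 1)) => x; rewrite -dual subrK.
split=> //; first exact: (bounded_operator_adjoint bS total rep).
  by move=> k; apply: (adjoint_eq bS total rep) => x; exact: dual.
have [_ [M M0 SM]] := bS; exists (M + 1) => [|k]; first by rewrite lerDr.
have [->|uk] := eqVneq (u k) 0; first by rewrite addr_ge0.
have /andP[Jk Jk1] := uJ _ uk; have hE := gram_hnorm gram.
have := SM (E k); rewrite SE hnormZ !hE // !mulr1 normc_real //.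
by move=> h; rewrite (le_trans h) // lerDl.
Qed.

End shift_models.

(** * Vectors generated by one basis vector *)

Lemma big_undup_fibers (V : nmodType) (I J : eqType) (h : I -> J) (s : seq I)
    (F : I -> V) :
  \sum_(i <- s) F i =
  \sum_(j <- undup (map h s)) \sum_(i <- s | h i == j) F i.
Proof.
rewrite (exchange_big_dep predT) //= !big_seq; apply: eq_bigr => i si.
rewrite -big_filter.
have -> : [seq j <- undup (map h s) | h i == j] = [:: h i].
  rewrite (@eq_filter _ _ (pred1 (h i))) => [|j]; last by rewrite /= eq_sym.
  by rewrite filter_pred1_uniq ?undup_uniq // mem_undup map_f.
by rewrite big_seq1.
Qed.

Section local_norm.
Context {R : realType}.
Implicit Types r : seq (R[i] * seq bool).

Lemma Re_sum (I : Type) (s : seq I) (F : I -> R[i]) :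
  complex.Re (\sum_(i <- s) F i) = \sum_(i <- s) complex.Re (F i).
Proof.
elim: s => [|i s IHs]; first by rewrite !big_nil.
by rewrite !big_cons -IHs; case: (F i) => a b; case: (\sum_(j <- s) F j).
Qed.

Lemma ReMr (z : R[i]) (a : R) : complex.Re (z * a%:C%C) = complex.Re z * a.
Proof. by case: z => x y; rewrite /= mulr0 subr0. Qed.

Lemma conjcM (a b : R[i]) : (a * b)^*%C = a^*%C * b^*%C.
Proof. exact: rmorphM. Qed.

(** The squared norm of a polynomial of the shift at a basis vector whose word
    weights are [c]: neither the index nor the space enters. *)
Definition local_norm r (c : seq bool -> R) : R :=
  \sum_(t <- r) \sum_(t' <- r) complex.Re (t.1 * t'.1^*%C) *
    (c t.2 * c t'.2 * (word_shift t.2 == word_shift t'.2)%:R).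

Lemma cvg_local_norm r (c : nat -> seq bool -> R) (l : seq bool -> R) :
  (forall m, c n m @[n --> \oo] --> l m) ->
  local_norm r (c n) @[n --> \oo] --> local_norm r l.
Proof.
move=> cl; apply: cvg_big => [|t _]; first exact: add_continuous.
apply: cvg_big => [|t' _]; first exact: add_continuous.
apply: cvgMr; apply: cvgMl; exact: cvgM.
Qed.

End local_norm.

Section model_theory.
Context {R : realType} {H : hilbertType R} {S S' : H -> H} {E : int -> H}.
Context {J : pred int} {u : int -> R}.
Hypothesis ES : shift_model S S' E J u.

Lemma word_eval_model m k :
  word_eval S S' m (E k) = (word_weight u m k)%:C%C *: E (k + word_shift m).
Proof.
elim: m k => [|b m IHm] k /=; first by rewrite addr0 scale1r.
rewrite IHm; case: b.
  rewrite (bounded_operatorMZ _ _ (model_adj ES)).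
  rewrite -[in LHS](subrK 1 (k + _)) (model_unshift ES) scalerA -rmorphM /=.
  by rewrite -addrA.
rewrite (bounded_operatorMZ _ _ (model_op ES)) (model_shift ES).
by rewrite scalerA -rmorphM /= subr0 -addrA.
Qed.

Lemma word_weight_domain m k : J k -> word_weight u m k != 0 ->
  J (k + word_shift m).
Proof.
move=> Jk; case: m => [|b m] /=; first by rewrite addr0.
rewrite mulf_eq0 negb_or => /andP[_ /(model_domain ES)].
case: b => /=; last by rewrite subr0 -addrA => /andP[].
by rewrite -addrA => /andP[].
Qed.

Lemma model_hnorm k : J k -> hnorm (E k) = 1.
Proof. exact/gram_hnorm/(model_gram ES). Qed.

Lemma model_eq0 k : ~~ J k -> E k = 0.
Proof.
move=> /negbTE Jk; apply: hnorm_eq0; apply/eqP; rewrite -sqrf_eq0; apply/eqP.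
by apply: complexI; rewrite -inner_hnorm (model_gram ES) Jk andbF.
Qed.

(** The vector q(S, S') E_k, for the polynomial q with the coefficients and words
    listed in [r], written out in the basis. *)
Definition local_vector (r : seq (R[i] * seq bool)) (k : int) : H :=
  \sum_(t <- r) (t.1 * (word_weight u t.2 k)%:C%C) *: E (k + word_shift t.2).

(** Two words contribute to the same basis vector exactly when they shift the
    index by the same amount. A word that would leave [J] has weight zero, which
    is why [J] does not show in [local_norm]. *)
Lemma hnorm_local_vector r k : J k ->
  hnorm (local_vector r k) ^+ 2 = local_norm r (fun m => word_weight u m k).
Proof.
move=> Jk; have := inner_hnorm (local_vector r k).
move=> /(congr1 (@complex.Re R)) /= <-.
rewrite [X in inner X _]/local_vector inner_suml Re_sum.
apply: eq_bigr => t _; rewrite inner_sumr Re_sum; apply: eq_bigr => t' _.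
rewrite innerZl innerZr (model_gram ES) conjcM conjc_real.
rewrite (inj_eq (addrI k)) -ReMr; congr complex.Re.
have [s_eq|_] := eqVneq (word_shift t.2) (word_shift t'.2); last first.
  by rewrite andFb !(rmorph0, mulr0).
rewrite mulr1 /=; have [c0|c0] := eqVneq (word_weight u t.2 k) 0.
  by rewrite c0 mul0r !(rmorph0, mulr0, mul0r).
by rewrite (word_weight_domain Jk c0) !rmorphM /=; ring.
Qed.

Definition poly_act (p : free_poly) (r : seq (R[i] * seq bool)) :=
  [seq (monalg.mcoeff m p * t.1, monalg.fmonom_val m ++ t.2)
    | m <- monalg.msupp p, t <- r].

Lemma poly_local_vector p r k :
  free_poly_eval p S S' (local_vector r k) = local_vector (poly_act p r) k.
Proof.
rewrite /local_vector /poly_act big_allpairs_dep; apply: eq_bigr => m _.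
have bw := bounded_operator_word m (model_op ES) (model_adj ES).
rewrite (bounded_operator_bigsum _ _ bw) scaler_sumr; apply: eq_bigr => t _.
rewrite (bounded_operatorMZ _ _ bw) word_eval_model !scalerA.
rewrite word_weight_cat word_shift_cat addrA; congr (_ *: _).
by rewrite rmorphM /= !mulrA.
Qed.

End model_theory.

(** * Blocks *)

Section blocks.
Context {R : realType} {H : hilbertType R} {S S' : H -> H} {E : int -> H}.
Context {J : pred int} {u : int -> R}.
Hypothesis ES : shift_model S S' E J u.

(** The index [l] can be reached from [k] through nonzero weights. The classes
    are the maximal intervals without a zero weight, but describing them by
    words makes the cyclic subspace generated by [E k] visible at once. *)
Definition same_block (u : int -> R) (k l : int) : Prop :=
  exists2 m, word_weight u m k != 0 & l = k + word_shift m.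

Lemma same_block_refl k : same_block u k k.
Proof. by exists [::]; rewrite ?oner_neq0 //= addr0. Qed.

Lemma same_block_sym k l : same_block u k l -> same_block u l k.
Proof.
move=> [m mk ->]; exists (adjoint_word m).
  by rewrite word_weight_adjoint.
by rewrite word_shift_adjoint addrK.
Qed.

Lemma same_block_trans k l n :
  same_block u k l -> same_block u l n -> same_block u k n.
Proof.
move=> [m mk ->] [m' ml ->]; exists (m' ++ m).
  by rewrite word_weight_cat mulf_neq0.
by rewrite word_shift_cat addrA.
Qed.

(** A representative of a block: [xget] makes the same choice for all the
    members of a block, as they define the same set. *)
Definition block_rep (k : int) : int := xget 0 (same_block u k).

Lemma block_repP k : same_block u k (block_rep k).
Proof.
apply: (@xgetPex _ 0 (same_block u k)); exists k; exact: same_block_refl.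
Qed.

Lemma block_rep_eq k l : same_block u k l -> block_rep k = block_rep l.
Proof.
move=> kl; congr xget; apply/seteqP; split=> n /= h.
  exact: same_block_trans (same_block_sym kl) h.
exact: same_block_trans kl h.
Qed.

Lemma inner_local_vector_block r r' k l : ~ same_block u k l ->
  inner (local_vector (E := E) (u := u) r k)
        (local_vector (E := E) (u := u) r' l) = 0.
Proof.
move=> kl; rewrite inner_suml big1 // => t _.
rewrite inner_sumr big1 // => t' _.
rewrite innerZl innerZr (model_gram ES).
have [c0|c0] := eqVneq (word_weight u t.2 k) 0.
  by rewrite c0 !(rmorph0, mulr0, mul0r).
have [d0|d0] := eqVneq (word_weight u t'.2 l) 0.
  by rewrite d0 mulr0 conjc0 mul0r mulr0.
have [kl_eq|] := eqVneq (k + _) (l + _); last by rewrite !mulr0.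
case: kl; apply: (@same_block_trans _ (k + word_shift t.2)).
  by exists t.2.
by apply: same_block_sym; exists t'.2.
Qed.

(** In a block each basis vector is a word applied to the representative,
    divided by the nonzero weight of that word. *)
Lemma block_decomposition x : linear_span E x ->
  exists (s : seq int) (r : int -> seq (R[i] * seq bool)),
  [/\ uniq s, {in s, forall k, J k},
      {in s &, forall k l, k != l -> ~ same_block u k l} &
      x = \sum_(k <- s) local_vector (E := E) (u := u) (r k) k].
Proof.
move=> [s0 [c ->]]; pose s := [seq k <- s0 | J k].
have -> : \sum_(k <- s0) c k *: E k = \sum_(k <- s) c k *: E k.
  rewrite big_filter [RHS]big_mkcond; apply: eq_bigr => k _.
  by case: ifPn => // Jk; rewrite (model_eq0 ES) // scaler0.
have sJ : {in s, forall k, J k} by move=> k /[!mem_filter] /andP[].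
clearbody s.
have word k : exists m, word_weight u m (block_rep k) != 0 /\
    k = block_rep k + word_shift m.
  by have [w] := same_block_sym (block_repP k); exists w.
have [m mP] := choice word.
pose r j := [seq (c k * (word_weight u (m k) j)%:C%C^-1, m k)
              | k <- s & block_rep k == j].
exists (undup (map block_rep s)), r; split; first exact: undup_uniq.
- move=> _ /[!mem_undup] /mapP[k /sJ Jk ->].
  by have [w kw ->] := block_repP k; exact: (word_weight_domain ES).
- move=> _ _ /[!mem_undup] /mapP[k _ ->] /mapP[l _ ->] kl h; case/eqP: kl.
  apply: block_rep_eq; apply: same_block_trans (block_repP k) _.
  exact: same_block_trans h (same_block_sym (block_repP l)).
rewrite (big_undup_fibers block_rep); apply: eq_bigr => j _.
rewrite /local_vector big_map big_filter; apply: eq_bigr => k /eqP kj.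
have [mk km] := mP k; rewrite -kj /= -km mulfVK //.
by rewrite -(rmorph0 (real_complex R)) (inj_eq (@complexI _)).
Qed.

End blocks.

Section operator_norms.
Context {R : realType} {H : hilbertType R}.

Lemma opnorm_ge0 (B : H -> H) : (0 <= opnorm B)%E.
Proof.
apply: (@le_trans _ _ (complex.Re `|B 0|)%:E).
  by rewrite lee_fin; exact: hnorm_ge0.
by apply: ereal_sup_ubound; exists 0 => //=; rewrite normr0.
Qed.

Lemma opnorm_le (B : H -> H) (c : R) : bounded_operator B -> 0 <= c ->
  (opnorm B <= c%:E)%E <-> forall x, hnorm (B x) <= c * hnorm x.
Proof.
move=> bB c0; split=> [Bc x|Bc]; last first.
  apply: ge_ereal_sup => _ [x /= x1 <-]; rewrite lee_fin.
  apply: le_trans (Bc x) _; apply: ler_piMr => //.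
  by rewrite -lecR -hnormE.
have [x0|x0] := eqVneq (hnorm x) 0.
  by rewrite (hnorm_eq0 x0) (bounded_operator_at0 bB) !hnorm0 mulr0.
have xpos : 0 < hnorm x by rewrite lt_def x0 hnorm_ge0.
rewrite -ler_pdivrMr // mulrC.
have nx : Normc.normc (hnorm x)^-1%:C%C = (hnorm x)^-1.
  by rewrite normc_real // invr_ge0 hnorm_ge0.
have -> : (hnorm x)^-1 * hnorm (B x) = hnorm (B ((hnorm x)^-1%:C%C *: x)).
  by rewrite (bounded_operatorMZ _ _ bB) hnormZ nx.
rewrite -lee_fin; apply: le_trans Bc; apply: ereal_sup_ubound.
exists ((hnorm x)^-1%:C%C *: x) => //=.
by rewrite hnormE hnormZ nx mulVf.
Qed.

End operator_norms.

(** * The local criterion *)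

Section criterion.
Context {R : realType}.

(** The vector state of each basis vector of the first shift is a limit, on
    words, of vector states of basis vectors of the second one. *)
Definition locally_approximable (J J' : pred int) (u v : int -> R) : Prop :=
  forall i, J i -> forall (n : nat) (eps : R), 0 < eps ->
  exists2 j, J' j & forall m, (size m <= n)%N ->
    `|word_weight u m i - word_weight v m j| < eps.

Lemma approximating_sequence J J' u v i :
  locally_approximable J J' u v -> J i ->
  exists2 j : nat -> int, forall n, J' (j n) &
    forall m, word_weight v m (j n) @[n --> \oo] --> word_weight u m i.
Proof.
move=> uv Ji.
have pick n : exists j, J' j /\ forall m, (size m <= n)%N ->
    `|word_weight u m i - word_weight v m j| < n.+1%:R^-1.
  have [|j J'j jP] := uv i Ji n n.+1%:R^-1; first by rewrite invr_gt0.
  by exists j.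
have [j jP] := choice pick; exists j => [n|m]; first exact: (jP n).1.
apply/cvgrPdist_lt => e e0.
have [N _ hN] := near_infty_natSinv_lt (PosNum e0).
exists (maxn N (size m)) => // n /=; rewrite geq_max => /andP[Nn mn].
by apply: lt_trans ((jP n).2 m mn) _; exact: hN.
Qed.

(** On a local vector at [k] the norm of p(S, S') is a continuous function of the
    word weights at [k]; these are limits of word weights of [B], where the
    bound by the norm of p(B, B') holds. Vectors from different blocks are
    orthogonal, and so are their images, so the bound passes to finite
    combinations of basis vectors, and to all vectors by density. *)
Lemma lhd_of_approximable (K H : hilbertType R) (S : K -> K) (B : H -> H)
    E F J J' u v :
  shift_model S (adjoint S) E J u -> shift_model B (adjoint B) F J' v ->
  locally_approximable J J' u v -> S ◁ B.
Proof.
move=> ES FB uv p.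
have bpS := bounded_operator_poly p (model_op ES) (model_adj ES).
have bpB := bounded_operator_poly p (model_op FB) (model_adj FB).
case opnE: (opnorm (free_poly_eval p B (adjoint B))) => [c| |]; first last.
- by have := opnorm_ge0 (free_poly_eval p B (adjoint B)); rewrite opnE.
- by rewrite leey.
have c0 : 0 <= c by rewrite -lee_fin -opnE opnorm_ge0.
have pBc : forall y, hnorm (free_poly_eval p B (adjoint B) y) <= c * hnorm y.
  by apply/opnorm_le => //; rewrite opnE.
apply/opnorm_le => //.
have local r k : J k ->
    hnorm (free_poly_eval p S (adjoint S) (local_vector (E := E) (u := u) r k))
      ^+ 2 <= c ^+ 2 * hnorm (local_vector (E := E) (u := u) r k) ^+ 2.
  move=> Jk; have [j J'j jP] := approximating_sequence uv Jk.
  rewrite (poly_local_vector ES) !(hnorm_local_vector ES) //.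
  apply: (@ler_cvg_to _ \oo _ _
    (fun n => local_norm (poly_act p r) (word_weight v ^~ (j n)))
    (fun n => c ^+ 2 * local_norm r (word_weight v ^~ (j n)))).
  - exact: cvg_local_norm.
  - by apply: cvgMr; exact: cvg_local_norm.
  apply: nearW => n.
  rewrite -!(hnorm_local_vector FB) // -(poly_local_vector FB).
  by rewrite -exprMn ler_pXn2r ?nnegrE ?mulr_ge0 ?hnorm_ge0.
apply: (bounded_operator_dense bpS (model_total ES) c0) => x Ex.
have [s [r [us sJ sblock ->]]] := block_decomposition ES Ex.
rewrite -(@ler_pXn2r _ 2) ?nnegrE ?mulr_ge0 ?hnorm_ge0 // exprMn.
rewrite (bounded_operator_bigsum _ _ bpS) !hnorm_sum_orthogonal //.
- rewrite mulr_sumr !big_seq; apply: ler_sum => k ks.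
  by apply: local; exact: sJ.
- move=> k l ks ls kl; apply: (inner_local_vector_block ES); exact: sblock.
move=> k l ks ls kl; rewrite !(poly_local_vector ES).
by apply: (inner_local_vector_block ES); exact: sblock.
Qed.

End criterion.

Section detection.
Context {R : realType}.

Definition free_poly_of (r : seq (R[i] * seq bool)) : free_poly :=
  \sum_(t <- r) monalg.mkmalgU (monalg.FMonom t.2) t.1.

Lemma free_poly_eval_of (H : hilbertType R) (B C : H -> H) r x :
  free_poly_eval (free_poly_of r) B C x =
  \sum_(t <- r) t.1 *: word_eval B C t.2 x.
Proof.
pose ev (d : finmap.finset_of (Phant (monalg.fmonom bool))) (p : free_poly) :=
  \sum_(m <- d) monalg.mcoeff m p *: word_eval B C m x.
have evw (d : finmap.finset_of (Phant (monalg.fmonom bool))) (p : free_poly) :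
    finmap.fsubset (monalg.msupp p) d -> free_poly_eval p B C x = ev d p.
  move=> sd; rewrite /ev /free_poly_eval.
  rewrite (finmap.big_fset_incl _ sd) // => m _ /monalg.mcoeff_outdom ->.
  by rewrite scale0r.
have evD (p q : free_poly) : free_poly_eval (p + q) B C x =
    free_poly_eval p B C x + free_poly_eval q B C x.
  pose d := finmap.fsetU (monalg.msupp p) (monalg.msupp q).
  rewrite (evw d) ?monalg.msuppD_le // (evw d p) ?finmap.fsubsetUl //.
  rewrite (evw d q) ?finmap.fsubsetUr // /ev -big_split /=.
  by apply: eq_bigr => m _; rewrite monalg.mcoeffD scalerDl.
elim: r => [|t r IHr]; rewrite /free_poly_of ?big_nil ?big_cons.
  by rewrite /free_poly_eval monalg.msupp0 big_nil.
rewrite evD -IHr; congr (_ + _).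
rewrite (evw _ _ monalg.msuppU_le) /ev finmap.big_seq_fset1.
by rewrite monalg.mcoeffUU.
Qed.

Fixpoint words (n : nat) : seq (seq bool) :=
  if n is n'.+1 then
    [::] :: map (cons true) (words n') ++ map (cons false) (words n')
  else [:: [::]].

Lemma mem_words m n : (size m <= n)%N -> m \in words n.
Proof.
elim: m n => [|b m IHm] [|n] //=; rewrite ltnS => /IHm mn.
rewrite inE mem_cat.
by case: b; rewrite (mem_map (can_inj (_ : cancel _ behead))) ?mn ?orbT.
Qed.

(** The eigenvalue at the basis vector [k] of the polynomial
    c - sum_m (m' m - a_m)^2, where m' is the adjoint of the word m; the operator
    m' m is diagonal, with eigenvalue the square of the weight of m. *)
Definition detector_value (W : seq (seq bool)) (a : seq bool -> R) (c : R)
    (u : int -> R) (k : int) : R :=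
  c - \sum_(m <- W) (word_weight u m k ^+ 2 - a m) ^+ 2.

Definition square_word (m : seq bool) := adjoint_word m ++ m.

(** The same polynomial with its squares expanded into words. *)
Definition detector (W : seq (seq bool)) (a : seq bool -> R) (c : R) :=
  free_poly_of (((c - \sum_(m <- W) a m ^+ 2)%:C%C, [::]) ::
    [seq (- 1, square_word m ++ square_word m) | m <- W] ++
    [seq ((2 * a m)%:C%C, square_word m) | m <- W]).

Lemma word_shift_square m : word_shift (square_word m) = 0.
Proof. by rewrite word_shift_cat word_shift_adjoint subrr. Qed.

Lemma word_weight_square (u : int -> R) m k :
  word_weight u (square_word m) k = word_weight u m k ^+ 2.
Proof. by rewrite word_weight_cat word_weight_adjoint. Qed.

Lemma detector_model (H : hilbertType R) (S S' : H -> H) E J u W a c k :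
  shift_model S S' E J u ->
  free_poly_eval (detector W a c) S S' (E k) =
  (detector_value W a c u k)%:C%C *: E k.
Proof.
move=> ES; rewrite free_poly_eval_of big_cons big_cat !big_map /=.
have -> : \sum_(m <- W) (- 1) *:
      word_eval S S' (square_word m ++ square_word m) (E k) =
    (- \sum_(m <- W) word_weight u m k ^+ 4)%:C%C *: E k.
  rewrite rmorphN rmorph_sum scaleNr scaler_suml -sumrN; apply: eq_bigr => m _.
  rewrite (word_eval_model ES) word_shift_cat word_shift_square !addr0.
  rewrite word_weight_cat word_shift_square addr0 !word_weight_square.
  by rewrite scaleN1r -exprD.
have -> : \sum_(m <- W) (2 * a m)%:C%C *: word_eval S S' (square_word m) (E k) =
    (\sum_(m <- W) 2 * a m * word_weight u m k ^+ 2)%:C%C *: E k.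
  rewrite rmorph_sum scaler_suml; apply: eq_bigr => m _.
  rewrite (word_eval_model ES) word_shift_square addr0 word_weight_square.
  by rewrite scalerA -rmorphM.
rewrite -!scalerDl -!rmorphD; congr (_%:C%C *: _).
rewrite /detector_value -addrA; congr (c + _).
rewrite -!sumrN -!big_split; apply: eq_bigr => m _ /=; ring.
Qed.

Lemma hnorm_diagonal (H : hilbertType R) (S S' : H -> H) E (J : pred int) u
    (G : H -> H) (g : int -> R) (c : R) :
  shift_model S S' E J u -> bounded_operator G -> 0 <= c ->
  (forall k, G (E k) = (g k)%:C%C *: E k) ->
  (forall k, J k -> 0 <= g k <= c) ->
  forall x, hnorm (G x) <= c * hnorm x.
Proof.
move=> ES bG c0 GE gc.
apply: (bounded_operator_dense bG (model_total ES) c0) => x [s [a ->]].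
rewrite (big_undup_fibers id) map_id.
pose y j := (\sum_(k <- s | k == j) a k) *: E j.
have -> : \sum_(j <- undup s) \sum_(k <- s | k == j) a k *: E k =
    \sum_(j <- undup s) y j.
  by apply: eq_bigr => j _; rewrite /y scaler_suml; apply: eq_bigr => k /eqP ->.
have yo k l : k != l -> inner (y k) (y l) = 0.
  move=> kl; rewrite innerZl innerZr (model_gram ES) (negbTE kl).
  by rewrite !mulr0.
have Gy k : G (y k) = (g k)%:C%C *: y k.
  by rewrite (bounded_operatorMZ _ _ bG) GE !scalerA mulrC.
rewrite -(@ler_pXn2r _ 2) ?nnegrE ?mulr_ge0 ?hnorm_ge0 // exprMn.
rewrite (bounded_operator_bigsum _ _ bG) !hnorm_sum_orthogonal ?undup_uniq //.
- rewrite mulr_sumr; apply: ler_sum => k _; rewrite Gy hnormZ -exprMn.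
  have [Jk|Jk] := boolP (J k); last first.
    by rewrite /y (model_eq0 ES) // scaler0 hnorm0 !mulr0.
  have /andP[g0 gle] := gc _ Jk.
  rewrite normc_real // ler_pXn2r ?nnegrE ?mulr_ge0 ?hnorm_ge0 //.
  by rewrite ler_wpM2r ?hnorm_ge0.
- by move=> k l _ _; exact: yo.
by move=> k l _ _ kl; rewrite !Gy innerZl innerZr yo // !mulr0.
Qed.

(** Suppose that the basis vector [i] of the first shift is eps-far from all those
    of the second. The detector centred at the word weights of [i] has norm at
    least c, its eigenvalue at [i], while its eigenvalues for the second shift
    lie between 0 and c - eps^4, because |x - y| <= |x + y| for nonnegative x
    and y turns a distance eps between weights into eps^2 between squares. *)
Lemma approximable_of_lhd (K H : hilbertType R) (S : K -> K) (B : H -> H)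
    E F J J' u v :
  shift_model S (adjoint S) E J u -> shift_model B (adjoint B) F J' v ->
  S ◁ B -> locally_approximable J J' u v.
Proof.
move=> ES FB SB i Ji n eps eps0; apply: contrapT => noj.
have far j : J' j -> exists2 m, (size m <= n)%N &
    eps <= `|word_weight u m i - word_weight v m j|.
  move=> J'j; apply: contrapT => nom; apply: noj; exists j => // m mn.
  by rewrite ltNge; apply/negP => h; apply: nom; exists m.
have [M M1 uM] := model_bounded ES; have [N N1 vN] := model_bounded FB.
pose L := Num.max M N.
have ww2 w m k : (forall k, 0 <= w k) -> (forall k, w k <= L) ->
    0 <= word_weight w m k ^+ 2 <= (L ^+ size m) ^+ 2.
  move=> w0 wL; rewrite sqr_ge0 ler_pXn2r ?nnegrE ?word_weight_le //.
    exact: word_weight_ge0.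
  by rewrite exprn_ge0 // le_max (le_trans ler01 M1).
have uL k : u k <= L by apply: le_trans (uM k) _; rewrite le_max lexx.
have vL k : v k <= L by apply: le_trans (vN k) _; rewrite le_max lexx orbT.
pose W := words n; pose a m := word_weight u m i ^+ 2.
(* the summand c0 of c keeps the eigenvalues for the second shift nonnegative *)
pose c0 := \sum_(m <- W) ((L ^+ size m) ^+ 2) ^+ 2; pose c := eps ^+ 4 + c0.
have c0_ge0 : 0 <= c0 by apply: sumr_ge0 => m _; exact: sqr_ge0.
have c_ge0 : 0 <= c by rewrite addr_ge0 // exprn_ge0 // ltW.
pose p := detector W a c.
have bpS := bounded_operator_poly p (model_op ES) (model_adj ES).
have bpB := bounded_operator_poly p (model_op FB) (model_adj FB).
have gv j : J' j -> 0 <= detector_value W a c v j <= c0.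
  move=> J'j; apply/andP; split.
    rewrite subr_ge0 (@le_trans _ _ c0) //; last first.
      by rewrite lerDr exprn_ge0 // ltW.
    apply: ler_sum => m _.
    have /andP[x0 x1] := ww2 v m j (model_ge0 FB) vL.
    have /andP[a0 a1] := ww2 u m i (model_ge0 ES) uL.
    by rewrite -subr_ge0 subr_sqr mulr_ge0 // /a; lra.
  have [m mn mfar] := far _ J'j.
  rewrite /detector_value /c addrAC gerDr subr_le0.
  rewrite (big_rem m) /=; last exact: mem_words.
  apply: ler_wpDr; first by apply: sumr_ge0 => m' _; exact: sqr_ge0.
  have := word_weight_ge0 m j (model_ge0 FB).
  have := word_weight_ge0 m i (model_ge0 ES).
  move: mfar; rewrite /a distrC.
  set x := word_weight u m i; set y := word_weight v m j => xy x0 y0.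
  have d0 : eps ^+ 2 <= (y - x) ^+ 2.
    by rewrite -[leRHS]real_normK ?num_real // ler_pXn2r ?nnegrE // ltW.
  have d1 : (y - x) ^+ 2 <= (y + x) ^+ 2.
    by rewrite -subr_ge0 subr_sqr mulr_ge0 //; lra.
  rewrite subr_sqr exprMn (exprM eps 2 2) expr2.
  by rewrite ler_pM ?sqr_ge0 // (le_trans d0).
have pB : forall x, hnorm (free_poly_eval p B (adjoint B) x) <= c0 * hnorm x.
  apply: (hnorm_diagonal FB bpB c0_ge0 _ gv) => k; exact: detector_model FB.
have pS : forall x, hnorm (free_poly_eval p S (adjoint S) x) <= c0 * hnorm x.
  apply/opnorm_le => //; apply: le_trans (SB p) _.
  by apply/opnorm_le.
have := pS (E i); rewrite (detector_model _ _ _ _ ES) /detector_value.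
rewrite big1 => [|m _]; last by rewrite subrr expr0n.
rewrite subr0 hnormZ (model_hnorm ES) // !mulr1 normc_real //.
by rewrite gerDr leNgt exprn_gt0.
Qed.

End detection.

(** * From weights to word weights and back *)

Section weights_and_words.
Context {R : realType}.
Implicit Types (u v : int -> R) (m : seq bool).

Lemma word_shift_le m : `|word_shift m| <= (size m)%:Z.
Proof. by elim: m => [|b m IHm] //=; case: b; lia. Qed.

(** A word of length at most [n] read at [i] stays inside the window from [a] to
    [b] as long as its weight for [u] is nonzero: each end of the window is
    either out of reach or closed by a zero weight of [u]. Once a zero is
    crossed, the weight for [v] has picked up a factor of at most [eps] and
    stays small, so that the weights of [v] outside the window do not matter
    beyond their bound [M]. *)
Lemma word_weight_close u v (M eps : R) (i s a b : int) (n : nat) m :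
  1 <= M -> 0 <= eps ->
  (forall k, 0 <= u k <= M) -> (forall k, 0 <= v k <= M) ->
  a <= i <= b ->
  (u (a - 1) = 0 \/ a <= i - n%:Z) -> (u b = 0 \/ i + n%:Z <= b) ->
  (forall k, a - 1 <= k <= b -> `|u k - v (k + s)| <= eps) ->
  (size m <= n)%N ->
  `|word_weight u m i - word_weight v m (i + s)|
    <= (size m)%:R * M ^+ size m * eps.
Proof.
move=> M1 eps0 u0M v0M /andP[ai ib] ua ub uv.
have u0 k : 0 <= u k by have /andP[] := u0M k.
have v0 k : 0 <= v k by have /andP[] := v0M k.
have uM k : u k <= M by have /andP[] := u0M k.
have vM k : v k <= M by have /andP[] := v0M k.
have M0 : 0 <= M by apply: le_trans M1.
suff : (size m <= n)%N ->
    `|word_weight u m i - word_weight v m (i + s)|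
      <= (size m)%:R * M ^+ size m * eps /\
    (word_weight u m i = 0 \/ a <= i + word_shift m <= b).
  by move=> h /h[].
elim: m => [|c m IHm] /=.
  by move=> _; split; [rewrite subrr normr0 !mul0r | right; lia].
move=> mn; have [close inside] := IHm (ltnW mn).
set k := i + word_shift m; set t := k - (if c then 1 else 0).
have -> : i + s + word_shift m - (if c then 1 else 0) = t + s.
  by rewrite /t /k; lia.
set p := word_weight u m i in close inside *.
set q := word_weight v m (i + s) in close *.
have q0 : 0 <= q by exact: word_weight_ge0.
have qM : q <= M ^+ size m by exact: word_weight_le.
have step : (size m)%:R * M ^+ size m * eps * M + M ^+ size m * eps <=
    (size m).+1%:R * M ^+ (size m).+1 * eps.
  rewrite -natr1 exprSr mulrDl mulrDl mul1r lerD //.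
    by rewrite mulrAC mulrA.
  by rewrite ler_wpM2r // ler_peMr // exprn_ge0.
split.
  apply: le_trans step; case: inside => [p0|/andP[ak kb]].
    rewrite p0 mul0r sub0r normrN normrM (ger0_norm q0) (ger0_norm (v0 _)).
    apply: ler_wpDr; first by rewrite mulr_ge0 // exprn_ge0.
    apply: ler_pM => //; move: close.
    by rewrite p0 sub0r normrN ger0_norm.
  have -> : p * u t - q * v (t + s) = (p - q) * u t + q * (u t - v (t + s)).
    by ring.
  apply: le_trans (ler_normD _ _) _.
  rewrite !normrM (ger0_norm q0) (ger0_norm (u0 t)).
  apply: lerD; apply: ler_pM => //; apply: uv.
  by rewrite /t; move: ak kb; rewrite -/k; clear; case: c; lia.
case: inside => [->|/andP[ak kb]]; first by left; rewrite mul0r.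
have := word_shift_le m; rewrite ler_norml => /andP[sm1 sm2].
have [h|h] := boolP (a <= i + (word_shift m + (if c then -1 else 1)) <= b).
  by right.
left; suff -> : u t = 0 by rewrite mulr0.
rewrite /t /k; clear -h ak kb ua ub sm1 sm2 mn; case: c h => h.
  case: ua => [<-|ua]; first by congr u; clear -h ak kb; lia.
  by exfalso; clear -h ak kb ua sm1 mn; lia.
case: ub => [<-|ub]; first by congr u; clear -h ak kb; lia.
by exfalso; clear -h ak kb ub sm2 mn; lia.
Qed.

Lemma approximable_of_windows (J J' : pred int) u v (M : R) :
  1 <= M -> (forall k, 0 <= u k <= M) -> (forall k, 0 <= v k <= M) ->
  (forall i, J i -> forall (n : nat) (eps : R), 0 < eps ->
    exists a b s : int, [/\ J' (i + s), a <= i <= b,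
      u (a - 1) = 0 \/ a <= i - n%:Z,
      u b = 0 \/ i + n%:Z <= b &
      forall k, a - 1 <= k <= b -> `|u k - v (k + s)| < eps]) ->
  locally_approximable J J' u v.
Proof.
move=> M1 u0M v0M win i Ji n eps eps0.
have M0 : 0 <= M by apply: le_trans M1.
have C0 : 0 < n%:R * M ^+ n + 1 by rewrite ltr_wpDl // mulr_ge0 // exprn_ge0.
have d0 : 0 < eps / (n%:R * M ^+ n + 1) by rewrite divr_gt0.
have [a [b [s [J's ai ua ub uv]]]] := win i Ji n _ d0.
exists (i + s) => // m mn.
apply: le_lt_trans (word_weight_close M1 (ltW d0) u0M v0M ai ua ub _ mn) _.
  by move=> k /uv /ltW.
rewrite mulrA ltr_pdivrMr // mulrC ltr_pM2l //.
rewrite ltr_pwDr // ler_pM ?exprn_ge0 ?ler_nat //.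
exact: ler_weXn2l.
Qed.

Lemma word_shift_forward t : word_shift (nseq t false) = t%:Z.
Proof. by elim: t => [|t IHt] //=; rewrite IHt; lia. Qed.

(** The powers of the shift have as word weights at [i] the products of the first
    weights from [i] on, so the weights are recovered as successive quotients,
    up to and including the first zero. The weight before [i] is the word
    weight of the adjoint itself. *)
Lemma window_of_approximable (J J' : pred int) u v i (n : nat) (eps : R) :
  locally_approximable J J' u v -> J i -> 0 < eps ->
  (forall l, (l < n)%N -> 0 < u (i + l%:Z)) ->
  exists2 j, J' j & `|u (i - 1) - v (j - 1)| < eps /\
    forall l, (l <= n)%N -> `|u (i + l%:Z) - v (j + l%:Z)| < eps.
Proof.
move=> uv Ji eps0 upos; have [j J'j jP] := approximating_sequence uv Ji.
have left_cvg : v (j N - 1) @[N --> \oo] --> u (i - 1).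
  have := jP [:: true]; rewrite /= mul1r addr0.
  by under eq_fun do rewrite mul1r addr0.
have right_cvg l : (l <= n)%N -> v (j N + l%:Z) @[N --> \oo] --> u (i + l%:Z).
  move=> ln.
  have pos : 0 < word_weight u (nseq l false) i.
    elim: l ln => [|l IHl] //= ln; rewrite mulr_gt0 ?IHl ?(ltnW ln) //.
    by rewrite word_shift_forward subr0 upos.
  have c0 := jP (nseq l false); have c1 := jP (nseq l.+1 false).
  have inv : (word_weight v (nseq l false) (j N))^-1 @[N --> \oo] -->
      (word_weight u (nseq l false) i)^-1.
    by apply: (cvgV _ c0); rewrite gt_eqF.
  have quot := @cvgM _ _ \oo _ _ _ _ _ inv c1.
  have <- : (word_weight u (nseq l false) i)^-1 *
      word_weight u (nseq l.+1 false) i = u (i + l%:Z).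
    by rewrite /= word_shift_forward subr0 mulKf ?gt_eqF.
  have near_eq : {near \oo, (fun N => (word_weight v (nseq l false) (j N))^-1 *
      word_weight v (nseq l.+1 false) (j N)) =1 (fun N => v (j N + l%:Z))}.
    have : \forall N \near \oo, 0 < word_weight v (nseq l false) (j N).
      exact: (cvgr_gt _ c0).
    apply: filterS => N vN /=.
    by rewrite word_shift_forward subr0 mulKf // gt_eqF.
  have fil : Filter \oo by exact: eventually_filter.
  exact: (cvg_trans (near_eq_cvg near_eq) (quot fil)).
have right_near : \forall N \near \oo, forall l : 'I_n.+1,
    `|u (i + (l : nat)%:Z) - v (j N + (l : nat)%:Z)| < eps.
  apply: filter_forall => l; have := right_cvg l.
  rewrite -ltnS => /(_ (ltn_ord l)).
  by move/cvgrPdist_lt; apply.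
move/cvgrPdist_lt : left_cvg => /(_ _ eps0) left_near.
have [N [lN rN]] := filter_ex (filterI left_near right_near).
exists (j N) => //; split=> // l ln.
by have := rN (Ordinal (ln : (l < n.+1)%N)).
Qed.

End weights_and_words.

(** * Patterns in an i.i.d. sequence *)

Section essential_range.
Context {d : measure_display} {Omega : measurableType d} {R : realType}.
Context {P : probability Omega R}.
Implicit Types X Y : {RV P >-> R}.

Lemma closed_essran X : closed (essran X).
Proof.
move=> x clx U oU Ux; have [y [Xy Uy]] := clx U (open_nbhs_nbhs (conj oU Ux)).
exact: Xy.
Qed.

Lemma essran_ge0 X x : (forall w, 0 <= X w) -> essran X x -> 0 <= x.
Proof.
move=> X0 Xx; rewrite leNgt; apply/negP => x0.
have := Xx [set y | y < 0] (@open_lt _ 0) x0.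
rewrite /distribution /pushforward (_ : _ @^-1` _ = set0) ?measure0 ?ltxx //.
by apply/seteqP; split=> w //=; rewrite ltNge X0.
Qed.

Lemma measurable_essran X : measurable (essran X).
Proof.
by apply: measurable_realfun.closed_measurable; exact: closed_essran.
Qed.

(** A point off the essential range has a null neighbourhood, hence lies in a
    null interval with rational end points, and these are countably many. *)
Lemma distribution_essranC X : distribution P X (~` essran X) = 0%E.
Proof.
have mC : measurable (~` essran X).
  by apply: measurableC; exact: measurable_essran.
apply/negligibleP => //.
pose I (p : rat * rat) : set R := `]ratr p.1, ratr p.2[%classic.
pose F n := if unpickle n is Some p then
    (if distribution P X (I p) == 0%E then I p else set0) else set0.
apply: (@negligibleS _ _ _ _ (\bigcup_n F n)); last first.
  apply: negligible_bigcup => n; rewrite /F; case: unpickle => [p|]; last first.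
    exact: negligible_set0.
  case: ifPn => [/eqP h|_]; last exact: negligible_set0.
  by apply/negligibleP => //; exact: measurable_itv.
move=> x /= nx.
have [U [oU Ux U0]] : exists U : set R,
    [/\ open U, U x & distribution P X U = 0%E].
  apply: contrapT => noU; apply: nx => U oU Ux.
  rewrite lt0e measure_ge0 andbT; apply/negP => /eqP U0.
  by apply: noU; exists U.
have /nbhs_ballP[e /= e0 eU] : nbhs x U by exact: open_nbhs_nbhs.
have xel : x - e < x by rewrite ltrBlDr ltrDl.
have xer : x < x + e by rewrite ltrDl.
have [p] := rat_in_itvoo xel; rewrite in_itv /= => /andP[p1 p2].
have [q] := rat_in_itvoo xer; rewrite in_itv /= => /andP[q1 q2].
have [n nE] : exists n, unpickle n = Some (p, q).
  by exists (pickle (p, q)); rewrite pickleK.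
exists n; first by [].
rewrite /F nE.
have -> : distribution P X (I (p, q)) == 0%E.
  rewrite -measure_le0 -U0; apply: le_measure.
  - by rewrite inE; exact: measurable_itv.
  - by rewrite inE; exact: measurable_realfun.open_measurable.
  move=> y; rewrite /I /= in_itv /= => /andP[py yq]; apply: eU => /=.
  by rewrite /ball /= ltr_distlC; apply/andP; split; lra.
by rewrite /I /= in_itv /= p2 q1.
Qed.

End essential_range.

Lemma bigcap_cons (T : Type) (I : eqType) (a : I) (s : seq I) (F : I -> set T) :
  \bigcap_(j in [set` a :: s]) F j = F a `&` \bigcap_(j in [set` s]) F j.
Proof.
apply/seteqP; split=> w /=; last case.
  by move=> h; split=> [|j js]; apply: h; rewrite /= inE ?eqxx ?js ?orbT.
by move=> wa ws j /=; rewrite inE => /orP[/eqP->|/ws].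
Qed.

Section patterns.
Context {d : measure_display} {Omega : measurableType d} {R : realType}.
Context {P : probability Omega R} {X : nat -> {RV P >-> R}}.
Hypothesis X_iid : iid X.

Lemma measurable_preimage n (D : set R) :
  measurable D -> measurable (X n @^-1` D).
Proof.
by move=> mD; have := measurable_funPT (X n) measurableT _ mD; rewrite setTI.
Qed.

Lemma ae_essran : {ae P, forall w, forall n, essran (X 0%N) (X n w)}.
Proof.
apply: ae_foralln => n; rewrite /prop_near1 /almost_everywhere /=.
have mC : measurable (~` essran (X 0%N)).
  by apply: measurableC; exact: measurable_essran.
apply/negligibleP.
  exact: (measurable_preimage n mC).
rewrite -(distribution_essranC (X 0%N)).
by rewrite -(X_iid.2 n 0%N _ mC).
Qed.

Variables (B : nat -> set R) (L : nat).
Hypothesis mB : forall k, measurable (B k).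

Definition pattern (j : nat) : set Omega :=
  [set w | forall k, (k < L)%N -> B k (X (j + k)%N w)].

Let q : R := \prod_(k <- iota 0 L) fine (distribution P (X 0%N) (B k)).

Let fin_dist (k : nat) : distribution P (X 0%N) (B k) \is a fin_num.
Proof. exact: fin_num_measure. Qed.

Let block_index (s : seq nat) :=
  [seq (j * L + k)%N | j <- s, k <- iota 0 L].

Lemma measurable_pattern j : measurable (pattern j).
Proof.
have -> : pattern j = \bigcap_(k in [set k | (k < L)%N]) X (j + k)%N @^-1` B k.
  by apply/seteqP; split=> w /= h k; exact: h.
by apply: bigcap_measurableType => k _; exact: measurable_preimage.
Qed.

Let uniq_block_index s : uniq s -> uniq (block_index s).
Proof.
move=> us; apply: allpairs_uniq => //; first exact: iota_uniq.
move=> [j k] [j' k'] /allpairsP[[a b] /= [_ + [-> ->]]].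
rewrite mem_iota add0n => /andP[_ kL].
move=> /allpairsP[[a' b'] /= [_ + [-> ->]]].
rewrite mem_iota add0n => /andP[_ kL'] e.
have L0 : (0 < L)%N by apply: leq_ltn_trans kL.
have := congr1 (fun n => n %/ L)%N e; rewrite !divnMDl // !divn_small // !addn0.
have := congr1 (fun n => n %% L)%N e; rewrite !modnMDl !modn_small //.
by move=> -> ->.
Qed.

(** The blocks involve disjoint sets of variables; the set of [w] with the pattern
    at all blocks in [s] is therefore a product event, with the constraint on
    the variable [n] given by the residue of [n] modulo [L]. *)
Lemma pattern_blocks s : uniq s ->
  P (\bigcap_(j in [set` s]) pattern (j * L)) = (q ^+ size s)%:E.
Proof.
move=> us; have := X_iid.1 (block_index s) (fun n => B (n %% L))
  (uniq_block_index us) (fun n => mB _).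
rewrite /block_index big_allpairs_dep => h.
have -> : \bigcap_(j in [set` s]) pattern (j * L) =
    \bigcap_(n in [set` block_index s]) X n @^-1` B (n %% L).
  apply/seteqP; split=> w /= hw.
    move=> _ /allpairsP[[j k] /= [js + ->]]; rewrite mem_iota add0n => kL.
    by have := hw j js k kL; rewrite modnMDl modn_small.
  move=> j js k kL; have := hw (j * L + k)%N.
  rewrite modnMDl modn_small //; apply.
  by apply/allpairsP; exists (j, k); rewrite mem_iota.
rewrite h {h us}; elim: s => [|j s IHs]; first by rewrite big_nil.
rewrite big_cons IHs exprS EFinM; congr (_ * _)%E.
rewrite /q -prodEFin !big_seq; apply: eq_bigr => k.
rewrite mem_iota add0n => /andP[_ kL]; rewrite modnMDl modn_small // fineK //.
exact: X_iid.2.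
Qed.

Lemma pattern_prob : P (pattern 0) = q%:E.
Proof.
have := @pattern_blocks [:: 0%N] isT; rewrite /= expr1 => <-; congr (P _).
apply/seteqP; split=> w /= hw; first by move=> j /=; rewrite inE => /eqP ->.
by apply: (hw 0%N); exact: mem_head.
Qed.

(** Inclusion-exclusion, one avoided block at a time: the event that block [a] is
    avoided is the difference of an event without [a] and an event where the
    pattern occurs at [a]. *)
Lemma pattern_avoid s s' : uniq (s ++ s') ->
  P ((\bigcap_(j in [set` s]) ~` pattern (j * L)) `&`
     (\bigcap_(j in [set` s']) pattern (j * L))) =
  ((1 - q) ^+ size s * q ^+ size s')%:E.
Proof.
have mF (t : seq nat) (G : nat -> set Omega) : (forall j, measurable (G j)) ->
    measurable (\bigcap_(j in [set` t]) G j).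
  by move=> mG; apply: bigcap_measurableType => j _; exact: mG.
have mp j : measurable (pattern (j * L)) by exact: measurable_pattern.
have mc j : measurable (~` pattern (j * L)) by exact: measurableC.
elim: s s' => [|a s IHs] s' us /=.
  rewrite mul1r -pattern_blocks //; congr (P _).
  by rewrite set_nil bigcap_set0 setTI.
have us1 : uniq (s ++ s') by move: us => /= /andP[].
have us2 : uniq (s ++ a :: s').
  by rewrite -cat1s uniq_catCA cat1s; exact: us.
set G := (\bigcap_(j in [set` s]) ~` pattern (j * L)) `&`
     (\bigcap_(j in [set` s']) pattern (j * L)).
have mG : measurable G by apply: measurableI; exact: mF.
have GI : G `&` pattern (a * L) =
    (\bigcap_(j in [set` s]) ~` pattern (j * L)) `&`
    (\bigcap_(j in [set` a :: s']) pattern (j * L)).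
  by rewrite bigcap_cons /G -setIA [pattern _ `&` _]setIC.
have GD : G `\` pattern (a * L) =
    (\bigcap_(j in [set` a :: s]) ~` pattern (j * L)) `&`
    (\bigcap_(j in [set` s']) pattern (j * L)).
  by rewrite bigcap_cons /G setDE setIAC [~` _ `&` _]setIC.
have h : P G = (P (G `\` pattern (a * L)) + P (G `&` pattern (a * L)))%E.
  exact: measureDI.
rewrite GI (IHs _ us2) (IHs _ us1 : P G = _) in h.
rewrite -GD.
have fin : P (G `\` pattern (a * L)) \is a fin_num.
  by apply: fin_num_measure; exact: measurableD.
move: h; rewrite -(fineK fin) -EFinD => -[h]; congr (_%:E).
by move: h; rewrite /= !exprS; set x := fine _ => h; lra.
Qed.

(** The probability that the pattern misses the first n of the disjoint blocks of
    length [L] is (1 - q)^n, which tends to 0. *)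
Lemma pattern_recurrence :
  (forall k, (k < L)%N -> (0 < distribution P (X 0%N) (B k))%E) ->
  {ae P, forall w, exists j, pattern j w}.
Proof.
move=> Bpos; have q0 : 0 < q.
  rewrite /q big_seq; apply: prodr_gt0 => k; rewrite mem_iota => /andP[_ kL].
  by rewrite -lte_fin fineK //; apply: Bpos.
have q1 : q <= 1.
  rewrite -lee_fin -pattern_prob probability_le1 //.
  exact: measurable_pattern.
rewrite /prop_near1 /almost_everywhere /=.
apply: (@negligibleS _ _ _ _ (\bigcap_j ~` pattern (j * L))).
  by move=> w /= nw j _ /= pw; apply: nw; exists (j * L)%N.
have mM : measurable (\bigcap_j ~` pattern (j * L)).
  apply: bigcapT_measurable => j; apply: measurableC.
  exact: measurable_pattern.
suff P0 : P (\bigcap_j ~` pattern (j * L)) = 0%E by exact/negligibleP.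
have le_pow n : (P (\bigcap_j ~` pattern (j * L)) <= ((1 - q) ^+ n)%:E)%E.
  have := @pattern_avoid (iota 0 n) [::]; rewrite cats0 iota_uniq => /(_ isT).
  rewrite /= mulr1 size_iota => <-; apply: le_measure; rewrite ?inE //.
    apply: measurableI; apply: bigcap_measurableType => j _.
      by apply: measurableC; exact: measurable_pattern.
    exact: measurable_pattern.
  by move=> w hw; split=> j //= _; exact: hw.
apply/eqP; rewrite eq_le measure_ge0 andbT.
have fin : P (\bigcap_j ~` pattern (j * L)) \is a fin_num.
  exact: fin_num_measure.
rewrite -(fineK fin) lee_fin.
have := @cvg_expr R (1 - q); rewrite ger0_norm ?subr_ge0 // => /(_ _) h.
have cst : (fun _ : nat => fine (P (\bigcap_j ~` pattern (j * L)))) x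
    @[x --> \oo] --> fine (P (\bigcap_j ~` pattern (j * L))) by exact: cvg_cst.
have pow0 : ((fun n => (1 - q) ^+ n) : nat -> R) x @[x --> \oo] --> 0.
  by apply: h; lra.
apply: (ler_cvg_to cst pow0).
by apply: nearW => n; rewrite -lee_fin fineK.
Qed.

Lemma pattern_gt0 :
  (forall k, (k < L)%N -> (0 < distribution P (X 0%N) (B k))%E) ->
  (0 < P (pattern 0))%E.
Proof.
move=> Bpos; rewrite pattern_prob lte_fin /q big_seq.
apply: prodr_gt0 => k; rewrite mem_iota => /andP[_ kL].
by rewrite -lte_fin fineK //; apply: Bpos.
Qed.

Lemma ae_pattern_exists (Q : Omega -> Prop) :
  (forall k, (k < L)%N -> (0 < distribution P (X 0%N) (B k))%E) ->
  {ae P, forall w, Q w} -> exists2 w, Q w & pattern 0 w.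
Proof.
move=> /pattern_gt0 p0 aeQ; apply: contrapT => noQ.
suff : P (pattern 0) = 0%E by move=> h; rewrite h ltxx in p0.
apply/negligibleP; first exact: measurable_pattern.
by apply: negligibleS aeQ => w /= pw Qw; apply: noQ; exists w.
Qed.

End patterns.

(** * The two shifts *)

Section concrete_shifts.
Context {R : realType}.

Definition nonneg_index : pred int := fun k => 0 <= k.

Definition extend_family (V : zmodType) (e : nat -> V) (k : int) : V :=
  if k is Posz n then e n else 0.

Lemma bilateral_model (K : hilbertType R) (f : int -> K) (lambda : int -> R)
    (A : {linear K -> K}) :
  orthonormal_basis f -> (forall i, 0 <= lambda i) ->
  bilateral_shift f lambda A -> shift_model A (adjoint A) f predT lambda.
Proof.
move=> [gram total] l0 [cA _ Af]; apply: shift_model_adjoint => //.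
- exact: bounded_operator_linear.
- by move=> i j; rewrite gram andbT.
Qed.

Lemma unilateral_model (H : hilbertType R) (e : nat -> H) (w : nat -> R)
    (T : {linear H -> H}) :
  orthonormal_basis e -> (forall n, 0 <= w n) -> unilateral_shift e w T ->
  shift_model T (adjoint T) (extend_family e) nonneg_index (extend_family w).
Proof.
move=> [gram total] w0 [cT Te]; apply: shift_model_adjoint => //.
- exact: bounded_operator_linear.
- by move=> [i|i] [j|j] /=; rewrite ?linear0l ?linear0r ?gram ?andbT ?andbF.
- apply/seteqP; split=> // x _.
  have : closure (linear_span e) x by rewrite total.
  apply: closureS => _ [s [c ->]]; exists (map Posz s), (fun k => c `|k|%N).
  by rewrite big_map.
- move=> [n|[|n]] /=; rewrite ?linear0 ?scale0r //.
    by rewrite Te; congr (_ *: e _); rewrite addn1.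
- by move=> [n|n] /=.
- by move=> [n|n]; rewrite ?eqxx //= => _; apply/andP; split.
Qed.

Lemma n_spectrumP (w : int -> R) (n : nat) (z : 'rV[R]_n) :
  (forall i, 0 <= w i) ->
  n_spectrum w n z <-> forall eps, 0 < eps ->
    exists i, forall j : 'I_n, `|z 0 j - w (i + (j : nat)%:Z)| < eps.
Proof.
move=> w0; split=> [cz eps eps0|h U].
  have /cz [_ [[i _ <-] /=]] :
      nbhs z [set y | forall j, `|z 0 j - y 0 j| < eps].
    apply/nbhs_ballP; exists eps => //= y [_ zy] j; exact: (zy 0 j).
  move=> ii; exists (i + 1) => j.
  by have := ii j; rewrite mxE (ger0_norm (w0 _)) intS addrA.
move=> zU; have /nbhs_ballP[eps /= eps0 eU] : nbhs z U by exact: zU.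
have [i ii] := h _ eps0.
exists (\row_(j < n) `|w (i - 1 + j.+1%:Z)|); split; first by exists (i - 1).
apply: eU; split=> // a j.
rewrite ord1 mxE (ger0_norm (w0 _)) intS addrA subrK; exact: ii.
Qed.

Lemma bounded_weights (H K : hilbertType R) (S S' : H -> H) (B B' : K -> K)
    E F J J' u v :
  shift_model S S' E J u -> shift_model B B' F J' v ->
  exists M : R, [/\ 1 <= M, forall k, 0 <= u k <= M & forall k, 0 <= v k <= M].
Proof.
move=> ES FB; have [M M1 uM] := model_bounded ES.
have [N N1 vN] := model_bounded FB.
exists (Num.max M N); split=> [|k|k].
- by rewrite le_max M1.
- by rewrite (model_ge0 ES) le_max uM.
- by rewrite (model_ge0 FB) le_max vN orbT.
Qed.

End concrete_shifts.

Section measurability.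
Context {d : measure_display} {Omega : measurableType d} {R : realType}.
Context {P : probability Omega R} {X : nat -> {RV P >-> R}}.

Let path (w : Omega) : int -> R := extend_family (fun n => X n w).

Lemma mem_words_size m n : m \in words n -> (size m <= n)%N.
Proof.
elim: n m => [|n IHn] m /=; first by rewrite inE => /eqP ->.
rewrite inE mem_cat => /orP[/eqP -> //|/orP[|] /mapP[m' /IHn ? ->] //].
Qed.

(** The local criterion with countably many quantifiers. *)
Lemma approximable_discrete (J J' : pred int) (u v : int -> R) :
  locally_approximable J J' u v <->
  forall i, J i -> forall n : nat, exists2 j, J' j &
    forall m, m \in words n ->
      `|word_weight u m i - word_weight v m j| < n.+1%:R^-1.
Proof.
split=> [h i Ji n|h i Ji n eps eps0].
  have [|j J'j jP] := h i Ji n n.+1%:R^-1; first by rewrite invr_gt0.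
  by exists j => // m /mem_words_size; exact: jP.
have [N _ hN] := near_infty_natSinv_lt (PosNum eps0).
have [j J'j jP] := h i Ji (maxn n N); exists j => // m mn.
apply: lt_trans (hN (maxn n N) (leq_maxr _ _)); apply: jP.
by apply: mem_words; rewrite leq_max mn.
Qed.

Lemma measurable_word_weight m k :
  measurable_fun setT (fun w => word_weight (path w) m k).
Proof.
elim: m => [|b m IHm] /=; first exact: measurable_cst.
apply: measurable_realfun.measurable_funM => //.
case: (k + _ - _) => n /=; last exact: measurable_cst.
exact: measurable_funPT.
Qed.

Lemma measurable_approximable (lambda : int -> R) :
  measurable [set w | locally_approximable predT nonneg_index lambda (path w)].
Proof.
pose G (i : int) (n j : nat) (m : seq bool) : set Omega :=
  [set w | `|word_weight lambda m i - word_weight (path w) m j%:Z|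
             < n.+1%:R^-1].
have mG i n j m : measurable (G i n j m).
  have := @measurable_word_weight m j%:Z measurableT
    (ball (word_weight lambda m i) n.+1%:R^-1).
  rewrite setTI; apply; apply: measurable_realfun.open_measurable.
  exact: ball_open.
pose D (i : int) : set Omega :=
  \bigcap_n \bigcup_j \bigcap_(m in [set` words n]) G i n j m.
have mD i : measurable (D i).
  apply: bigcapT_measurable => n; apply: bigcupT_measurable => j.
  by apply: fin_bigcap_measurable => // m _; exact: mG.
have -> : [set w | locally_approximable predT nonneg_index lambda (path w)] =
    (\bigcap_(n : nat) D n%:Z) `&` (\bigcap_(n : nat) D (Negz n)).
  apply/seteqP; split=> w /=.
    move=> /approximable_discrete h.
    have Di i : D i w.
      move=> n _; have [[j|//] _ jP] := h i isT n.
      by exists j => // m; exact: jP.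
    by split=> n _; exact: Di.
  move=> [Dp Dn]; apply/approximable_discrete => i _ n.
  have Di : D i w by case: i => i; [exact: Dp | exact: Dn].
  by have [j _ jP] := Di n Logic.I; exists j%:Z => // m; exact: jP.
by apply: measurableI; apply: bigcapT_measurable.
Qed.

End measurability.

(** * Random and deterministic windows *)

Section comparison.
Context {R : realType} {d : measure_display} {Omega : measurableType d}.
Context {P : probability Omega R} {X : nat -> {RV P >-> R}}.
Hypotheses (X_ge0 : forall n w, 0 <= X n w) (X_iid : iid X).
Context {H : hilbertType R} {e : nat -> H} {T : Omega -> {linear H -> H}}.
Hypothesis e_onb : orthonormal_basis e.
Hypothesis T_shift : forall w, unilateral_shift e (fun n => X n w) (T w).
Context {K : hilbertType R} {f : int -> K} {lambda : int -> R}.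
Context {A : {linear K -> K}}.
Hypotheses (f_onb : orthonormal_basis f) (lambda_ge0 : forall i, 0 <= lambda i).
Hypothesis A_shift : bilateral_shift f lambda A.

Let Gamma := essran (X 0%N).
Let path (w : Omega) : int -> R := extend_family (fun n => X n w).

Let T_model w : shift_model (T w) (adjoint (T w)) (extend_family e)
  nonneg_index (path w).
Proof. by apply: unilateral_model => // n; exact: X_ge0. Qed.

Let A_model : shift_model A (adjoint A) f predT lambda.
Proof. exact: bilateral_model. Qed.

Lemma random_lhdP w :
  T w ◁ A <-> locally_approximable nonneg_index predT (path w) lambda.
Proof.
split; first exact: approximable_of_lhd (T_model w) A_model.
exact: lhd_of_approximable (T_model w) A_model.
Qed.

Lemma lhd_randomP w :
  A ◁ T w <-> locally_approximable predT nonneg_index lambda (path w).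
Proof.
split; first exact: approximable_of_lhd A_model (T_model w).
exact: lhd_of_approximable A_model (T_model w).
Qed.

Lemma measurable_lhd_random : measurable [set w | A ◁ T w].
Proof.
have -> : [set w | A ◁ T w] =
    [set w | locally_approximable predT nonneg_index lambda (path w)].
  by apply/seteqP; split=> w /= /lhd_randomP.
exact: measurable_approximable.
Qed.

Lemma spectrum1_subset :
  n_spectrum lambda 1 `<=` cartesian_power Gamma 1 <->
  forall i, Gamma (lambda i).
Proof.
split=> [sub i|sub z /n_spectrumP zP j].
  have : n_spectrum lambda 1 (\row__ lambda i).
    apply/n_spectrumP => // eps eps0; exists i => j.
    by rewrite ord1 mxE addr0 subrr normr0.
  by move=> /sub /(_ 0); rewrite mxE.
apply: (@closed_essran _ _ _ _ (X 0%N)) => U /nbhs_ballP[eps /= eps0 eU].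
have [i /(_ j) ij] := zP lambda_ge0 _ eps0.
by exists (lambda (i + (j : nat)%:Z)); split; [exact: sub | exact: eU].
Qed.

Lemma ae_forall_int (Q : int -> Omega -> Prop) :
  (forall i, {ae P, forall w, Q i w}) -> {ae P, forall w, forall i, Q i w}.
Proof.
move=> aeQ; have pos := ae_foralln (fun n : nat => aeQ n%:Z).
have neg := ae_foralln (fun n : nat => aeQ (Negz n)).
by apply: filterS2 pos neg => w pw nw [].
Qed.

(** Recurrence provides copies of each window of [lambda] among the variables; the
    basis vectors of [A] see no more than such a window. *)
Lemma ae_lhd_random :
  (forall i, Gamma (lambda i)) -> {ae P, forall w, A ◁ T w}.
Proof.
move=> Gl; pose B (i : int) (n k : nat) : set R :=
  ball (lambda (i - n%:Z - 1 + k%:Z)) n.+1%:R^-1.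
have : {ae P, forall w, forall i (n : nat),
    exists j, pattern (X := X) (B i n) (n + n + 2) j w}.
  apply: ae_forall_int => i; apply: ae_foralln => n.
  apply: (pattern_recurrence X_iid) => [k|k _].
    by apply: measurable_realfun.open_measurable; exact: ball_open.
  by apply: Gl; [exact: ball_open | exact: ballxx].
apply: filterS => w wP; apply/lhd_randomP.
have [M [M1 lM pM]] := bounded_weights A_model (T_model w).
apply: (approximable_of_windows M1 lM pM) => i _ n eps eps0.
have [N _ hN] := near_infty_natSinv_lt (PosNum eps0).
pose n' := maxn n N; have [j jP] := wP i n'.
have nn' : (n <= n')%N by exact: leq_maxl.
exists (i - n'%:Z), (i + n'%:Z), (j%:Z - (i - n'%:Z - 1)).
split; [rewrite /nonneg_index /=; lia | lia | right; lia | right; lia |].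
move=> k /andP[k1 k2].
have [t kE tn] : exists2 t : nat,
    k = i - n'%:Z - 1 + t%:Z & (t < n' + n' + 2)%N.
  by exists (absz (k - (i - n'%:Z - 1))%R); lia.
have := jP t tn; rewrite /B /ball /= -kE => h.
have -> : k + (j%:Z - (i - n'%:Z - 1)) = (j + t)%N%:Z by lia.
apply: lt_trans (h) _; apply: (hN n'); exact: leq_maxr.
Qed.

Lemma not_lhd_random i w : ~ Gamma (lambda i) ->
  (forall n, Gamma (X n w)) -> ~ A ◁ T w.
Proof.
move=> Gi GX /lhd_randomP AT; apply: Gi.
apply: (@closed_essran _ _ _ _ (X 0%N)) => U /nbhs_ballP[eps /= eps0 eU].
have [|[j|//] _ [_ /(_ 0%N (leqnn 0))]] :=
    window_of_approximable (n := 0) AT (i := i) isT eps0; first by [].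
rewrite !addr0 => ij; exists (X j w); split; [exact: GX | exact: eU].
Qed.

(** The variables 0 to [n] are close to [g 0], ..., [g n] with positive
    probability, hence for some sample with T w ◁ A. The basis vector at the
    left end of this random shift then sees the window (0, g 0, ..., g n), up
    to eps / 2. *)
Lemma window_of_ae_lhd (n : nat) (g : nat -> R) (eps : R) :
  {ae P, forall w, T w ◁ A} ->
  (forall k, (k <= n)%N -> Gamma (g k)) -> (forall k, (k < n)%N -> 0 < g k) ->
  0 < eps ->
  exists j : int, lambda (j - 1) < eps /\
    forall k, (k <= n)%N -> `|g k - lambda (j + k%:Z)| < eps.
Proof.
move=> aeT Gg gpos eps0.
have e20 : 0 < eps / 2 by rewrite divr_gt0.
pose B (k : nat) : set R :=
  ball (g k) (eps / 2) `&` (if (k < n)%N then [set x | 0 < x] else setT).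
have oB k : open (B k).
  apply: openI; first exact: ball_open.
  by case: ifP => _; [exact: open_gt | exact: openT].
have [||w Tw Bw] := @ae_pattern_exists _ _ _ _ _ X_iid B n.+1 _ _ _ aeT.
- by move=> k; apply: measurable_realfun.open_measurable.
- move=> k kn; apply: Gg; [exact: kn | exact: oB | split; first exact: ballxx].
  by case: ifP => // /gpos.
have /random_lhdP Tloc := Tw.
have [|j _ [jl jr]] := window_of_approximable (n := n) Tloc (i := 0) isT e20.
  move=> l ln; rewrite add0r /=.
  by have [_] := Bw l (ltnW ln : (l < n.+1)%N); rewrite ln add0n.
exists j; split.
  move: jl; rewrite /path /= sub0r normrN ger0_norm // => jl.
  by apply: lt_trans jl _; rewrite ltr_pdivrMr // ltr_pMr // ltr1n.
move=> k kn; have := jr k kn; have [+ _] := Bw k (kn : (k < n.+1)%N).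
rewrite /ball /= ?add0r ?add0n => h1 h2.
rewrite -(subrKA (X k w)) (le_lt_trans (ler_normD _ _)) //.
by rewrite [ltRHS](splitr eps) ltrD.
Qed.

(** What a basis vector of the random shift sees is part of a window starting at
    the left end, where a zero stops every word. *)
Lemma lhd_of_initial_windows w :
  (forall (N : nat) (eps : R), 0 < eps -> exists j : int,
    lambda (j - 1) < eps /\
    forall k, (k <= N)%N -> `|X k w - lambda (j + k%:Z)| < eps) -> T w ◁ A.
Proof.
move=> win; apply/random_lhdP.
have [M [M1 pM lM]] := bounded_weights (T_model w) A_model.
apply: (approximable_of_windows M1 pM lM) => -[i|//] _ n eps eps0.
have [j [jl jr]] := win (i + n)%N _ eps0.
exists 0, (i + n)%N%:Z, j; split=> //; first by lia.
- by left.
- by right; lia.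
move=> [k|k] /andP[k1 k2].
  by rewrite /path /= (addrC _ j); apply: jr; lia.
have -> : Negz k + j = j - 1 by lia.
by rewrite /path /= sub0r normrN ger0_norm.
Qed.

(** What a basis vector of the random shift sees is limited by the last zero before
    it and the first zero after it. *)
Lemma lhd_of_block_windows w :
  (forall n, exists2 m, (n <= m)%N & X m w = 0) ->
  (forall (a n : nat) (eps : R), 0 < eps ->
    (forall k, (k < n)%N -> X (a + k)%N w != 0) ->
    exists j : int, [/\ lambda (j - 1) < eps, lambda (j + n%:Z) < eps &
      forall k, (k < n)%N -> `|X (a + k)%N w - lambda (j + k%:Z)| < eps]) ->
  T w ◁ A.
Proof.
move=> zeros win; apply/random_lhdP.
have [M [M1 pM lM]] := bounded_weights (T_model w) A_model.
apply: (approximable_of_windows M1 pM lM) => -[i|//] _ n eps eps0.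
have [a [ai a0 aX]] : exists a, [/\ (a <= i)%N, path w (a%:Z - 1) = 0 &
    forall k, (a <= k < i)%N -> X k w != 0].
  elim: (i) => [|i' [a [ai a0 aX]]]; first by exists 0%N.
  have [Xi|Xi] := eqVneq (X i' w) 0.
    exists i'.+1; split=> // [|k]; last by lia.
    by have -> : i'.+1%:Z - 1 = i' by lia.
  exists a; split=> // [|k /andP[ak]]; first exact: leqW.
  rewrite ltnS leq_eqVlt => /orP[/eqP -> //|ki].
  by apply: aX; rewrite ak.
have exb : exists b, (i <= b)%N && (X b w == 0).
  by have [b ib /eqP Xb] := zeros i; exists b; rewrite ib.
have [b /andP[ib /eqP Xb] bmin] := ex_minnP exb.
have ab : (a <= b)%N by exact: leq_trans ai ib.
have [k kb|j [jl jb jr]] := win a (b - a)%N _ eps0.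
  have [ki|ki] := ltnP (a + k) i; first by apply: aX; rewrite leq_addr.
  apply/negP => Xk; have := bmin (a + k)%N; rewrite ki Xk => /(_ isT).
  by rewrite leqNgt; move: kb; rewrite ltn_subRL => ->.
exists a%:Z, b%:Z, (j - a%:Z); split=> //; first by lia.
- by left.
- by left.
move=> k /andP[k1 k2].
have [k_left|[k_right|[t tb kE]]] : k = a%:Z - 1 \/ (k = b%:Z \/
    exists2 t : nat, (t < b - a)%N & k = (a + t)%N%:Z).
  have [|kl] := eqVneq k (a%:Z - 1); first by left.
  have [|kr] := eqVneq k b%:Z; first by right; left.
  by right; right; exists (absz (k - a%:Z)%R); lia.
- rewrite k_left a0 sub0r normrN ger0_norm //.
  by have -> : a%:Z - 1 + (j - a%:Z) = j - 1 by lia.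
- rewrite k_right /path /= Xb sub0r normrN ger0_norm //.
  by have -> : b%:Z + (j - a%:Z) = j + (b - a)%N%:Z by lia.
rewrite kE /path /=.
have -> : (a + t)%N%:Z + (j - a%:Z) = j + t%:Z by lia.
exact: jr.
Qed.

(** A zero that is isolated in the essential range is an atom, hence recurs. *)
Lemma ae_zeros : isolated Gamma 0 ->
  {ae P, forall w, forall n, exists2 m, (n <= m)%N & X m w = 0}.
Proof.
move=> [/set_mem G0 [V V0 VG]]; apply: ae_foralln => n.
pose B (k : nat) : set R := if (k == n)%N then [set 0] else setT.
have mB k : measurable (B k) by rewrite /B; case: ifP.
have atom : (0 < distribution P (X 0%N) [set 0%R])%E.
  move: V0; rewrite nbhsE => -[U [oU U0] UV].
  have mU : measurable U by exact: measurable_realfun.open_measurable.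
  have mG := measurable_essran (X 0%N).
  apply: lt_le_trans (G0 U oU U0) _.
  have UD : distribution P (X 0%N) (U `\` essran (X 0%N)) = 0%E.
    apply/eqP; rewrite -measure_le0 -(distribution_essranC (X 0%N)).
    apply: le_measure; rewrite ?inE.
    - exact: measurableD.
    - exact: measurableC.
    exact: subDsetr.
  have -> : distribution P (X 0%N) U =
      (distribution P (X 0%N) (U `\` essran (X 0%N)) +
       distribution P (X 0%N) (U `&` essran (X 0%N)))%E by exact: measureDI.
  rewrite UD add0e; apply: le_measure; rewrite ?inE //.
    exact: measurableI.
  by move=> x [Ux Gx]; rewrite -VG; split => //; exact: UV.
have : {ae P, forall w, exists j, pattern (X := X) B n.+1 j w}.
  apply: (pattern_recurrence X_iid mB) => k kn; rewrite /B; case: ifP => // _.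
  by rewrite probability_setT.
apply: filterS => w [j jP]; exists (j + n)%N; first exact: leq_addl.
by have := jP n (ltnSn n); rewrite /B eqxx.
Qed.

Definition row_entry n (u : 'rV[R]_n) (k : nat) : R :=
  oapp (fun i : 'I_n => u 0 i) 0 (insub k).

Lemma row_entryE n (u : 'rV[R]_n) (k : 'I_n) : row_entry u k = u 0 k.
Proof. by rewrite /row_entry valK. Qed.

Lemma spectrum_left0P n (u : 'rV[R]_n) :
  n_spectrum lambda (1 + n) (row_mx (0 : 'rV[R]_1) u) <->
  forall eps, 0 < eps -> exists j : int, lambda (j - 1) < eps /\
    forall k : 'I_n, `|u 0 k - lambda (j + (k : nat)%:Z)| < eps.
Proof.
split=> [/n_spectrumP h eps eps0|h].
  have [i ii] := h lambda_ge0 eps eps0; exists (i + 1); split.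
    have := ii (lshift n 0); rewrite row_mxEl mxE sub0r normrN ger0_norm //=.
    by rewrite addr0 addrK.
  move=> k; have := ii (rshift 1 k); rewrite row_mxEr /=.
  by rewrite add1n intS addrA.
apply/n_spectrumP => // eps eps0; have [j [jl jr]] := h eps eps0.
exists (j - 1) => k; rewrite mxE; case: splitP => t kt.
  rewrite kt ord1 mxE sub0r normrN ger0_norm //= addr0; exact: jl.
by rewrite kt add1n intS addrA subrK; exact: jr.
Qed.

Lemma spectrum_both0P n (u : 'rV[R]_n) :
  n_spectrum lambda (1 + n + 1)
    (row_mx (row_mx (0 : 'rV[R]_1) u) (0 : 'rV[R]_1)) <->
  forall eps, 0 < eps -> exists j : int,
    [/\ lambda (j - 1) < eps, lambda (j + n%:Z) < eps &
    forall k : 'I_n, `|u 0 k - lambda (j + (k : nat)%:Z)| < eps].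
Proof.
split=> [/n_spectrumP h eps eps0|h].
  have [i ii] := h lambda_ge0 eps eps0; exists (i + 1); split.
  - have := ii (lshift 1 (lshift n 0)).
    rewrite !row_mxEl mxE sub0r normrN ger0_norm //=.
    by rewrite addr0 addrK.
  - have := ii (rshift (1 + n) 0).
    rewrite row_mxEr mxE sub0r normrN ger0_norm //=.
    by rewrite addn0 add1n intS addrA.
  move=> k; have := ii (lshift 1 (rshift 1 k)); rewrite row_mxEl row_mxEr /=.
  by rewrite add1n intS addrA.
apply/n_spectrumP => // eps eps0; have [j [jl jb jr]] := h eps eps0.
exists (j - 1) => k; rewrite mxE; case: splitP => t kt; last first.
  rewrite kt ord1 mxE sub0r normrN ger0_norm //= addn0 add1n intS addrA subrK.
  exact: jb.
rewrite mxE; case: splitP => r tr; rewrite kt tr.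
  rewrite ord1 mxE sub0r normrN ger0_norm //= addr0; exact: jl.
by rewrite add1n intS addrA subrK; exact: jr.
Qed.

Lemma essran_pos x : essran (X 0%N) x -> x != 0 -> 0 < x.
Proof.
by move=> Gx x0; rewrite lt_def x0 /= (essran_ge0 (X_ge0 0%N) Gx).
Qed.

Lemma random_lhd_invertible : ~ Gamma 0 ->
  {ae P, forall w, T w ◁ A} <->
  forall n, (1 <= n)%N ->
    [set row_mx (0 : 'rV[R]_1) u | u in cartesian_power Gamma n]
      `<=` n_spectrum lambda (1 + n)%N.
Proof.
move=> G0; split=> [aeT [//|n] _ _ [u Gu <-]|sub].
  apply/spectrum_left0P => eps eps0.
  have Gk k : (k <= n)%N -> Gamma (row_entry u k).
    move=> kn; rewrite (row_entryE u (Ordinal (kn : (k < n.+1)%N))).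
    exact: Gu.
  have [|j [jl jr]] := window_of_ae_lhd (n := n) aeT Gk _ eps0.
    move=> k /ltnW /Gk Guk; apply: essran_pos => //.
    by apply: contra_not_neq G0 => <-.
  exists j; split=> // k; rewrite -row_entryE; apply: jr.
  by rewrite -ltnS.
apply: filterS (ae_essran X_iid) => w GX; apply: lhd_of_initial_windows.
move=> N eps eps0; pose u : 'rV[R]_N.+1 := \row_(k < N.+1) X k w.
have /spectrum_left0P /(_ _ eps0) [j [jl jr]] :
    n_spectrum lambda (1 + N.+1) (row_mx (0 : 'rV[R]_1) u).
  by apply: sub => //; exists u => // k; rewrite mxE; exact: GX.
exists j; split=> // k kN.
by have := jr (Ordinal (kN : (k < N.+1)%N)); rewrite mxE.
Qed.

(** A zero inside a window would hide the weights after it; as 0 is a limit of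
    positive elements of Gamma, the zeros of a window can be replaced by small
    positive weights. Conversely 0 belongs to Gamma, so that a window of
    variables preceded by 0 is itself a window over Gamma. *)
Lemma random_lhd_accumulation : limit_point Gamma 0 ->
  {ae P, forall w, T w ◁ A} <->
  forall n, (1 <= n)%N -> cartesian_power Gamma n `<=` n_spectrum lambda n.
Proof.
move=> G0; split=> [aeT [//|n] _ u Gu|sub].
  apply/n_spectrumP => // eps eps0.
  have e20 : 0 < eps / 2 by rewrite divr_gt0.
  have [y [y0 Gy]] := G0 _ (nbhsx_ballx 0 _ e20).
  rewrite /ball /= sub0r normrN => ye.
  pose g k := if row_entry u k == 0 then y else row_entry u k.
  have Gk k : (k <= n)%N -> Gamma (g k).
    rewrite /g; case: ifP => // _ kn.
    by rewrite (row_entryE u (Ordinal (kn : (k < n.+1)%N))); exact: Gu.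
  have [|j [_ jr]] := window_of_ae_lhd (n := n) aeT Gk _ e20.
    move=> k /ltnW /Gk Ggk; apply: essran_pos => //.
    by rewrite /g; case: ifP => // /negbT.
  exists j => k; have := jr k; rewrite -ltnS => /(_ (ltn_ord k)) => h.
  rewrite -(subrKA (g k)) (le_lt_trans (ler_normD _ _)) //.
  rewrite [ltRHS](splitr eps) ltrD //.
  rewrite /g row_entryE; case: eqP => [->|_]; first by rewrite sub0r normrN.
  by rewrite subrr normr0.
have Gam0 : Gamma 0.
  apply: (@closed_essran _ _ _ _ (X 0%N)) => U U0.
  by have [y [_ Gy Uy]] := G0 U U0; exists y.
apply: filterS (ae_essran X_iid) => w GX; apply: lhd_of_initial_windows.
move=> N eps eps0; pose u : 'rV[R]_N.+1 := \row_(k < N.+1) X k w.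
have /spectrum_left0P /(_ _ eps0) [j [jl jr]] :
    n_spectrum lambda (1 + N.+1) (row_mx (0 : 'rV[R]_1) u).
  apply: sub => // k; rewrite mxE; case: splitP => t _; rewrite mxE //.
  exact: GX.
exists j; split=> // k kN.
by have := jr (Ordinal (kN : (k < N.+1)%N)); rewrite mxE.
Qed.

Lemma random_lhd_isolated : isolated Gamma 0 ->
  {ae P, forall w, T w ◁ A} <->
  forall n, [set row_mx (row_mx (0 : 'rV[R]_1) u) (0 : 'rV[R]_1)
      | u in cartesian_power (Gamma `\ 0) n]
    `<=` n_spectrum lambda (1 + n + 1)%N.
Proof.
move=> iso; have Gam0 : Gamma 0 by have [/set_mem] := iso.
split=> [aeT n _ [u Gu <-]|sub].
  apply/spectrum_both0P => eps eps0.
  pose g k := if (k < n)%N then row_entry u k else 0.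
  have gE (k : 'I_n) : g k = u 0 k by rewrite /g ltn_ord row_entryE.
  have Gk k : (k <= n)%N -> Gamma (g k).
    move=> _; have [kn|kn] := ltnP k n; last by rewrite /g ltnNge kn.
    by rewrite (gE (Ordinal kn)); have [] := Gu (Ordinal kn).
  have [|j [jl jr]] := window_of_ae_lhd (n := n) aeT Gk _ eps0.
    move=> k kn; apply: essran_pos; first exact/Gk/ltnW.
    by rewrite (gE (Ordinal kn)); have [_ /eqP] := Gu (Ordinal kn).
  exists j; split=> // [|k].
    by have := jr n (leqnn n); rewrite /g ltnn sub0r normrN ger0_norm.
  by rewrite -gE; apply: jr; exact: ltnW.
apply: filterS2 (ae_essran X_iid) (ae_zeros iso) => w GX zeros.
apply: lhd_of_block_windows zeros _ => a n eps eps0 Xn0.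
pose u : 'rV[R]_n := \row_(k < n) X (a + k)%N w.
have /spectrum_both0P /(_ _ eps0) [j [jl jb jr]] :
    n_spectrum lambda (1 + n + 1)
      (row_mx (row_mx (0 : 'rV[R]_1) u) (0 : 'rV[R]_1)).
  apply: sub; exists u => // k; rewrite mxE; split; first exact: GX.
  by apply/eqP/Xn0.
exists j; split=> // k kn.
by have := jr (Ordinal kn); rewrite mxE.
Qed.

End comparison.

(** * The comparison theorem *)

(* The basis e_1, e_2, ... and the variables X_1, X_2, ... are indexed from 0. *)
Theorem theorem6p23 (R : realType)
    (d : measure_display) (Omega : measurableType d) (P : probability Omega R)
    (X : nat -> {RV P >-> R})
    (X_ge0 : forall n w, 0 <= X n w)
    (X_bounded : forall n, exists M, forall w, X n w <= M)
    (X_iid : iid X)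
    (H : hilbertType R) (e : nat -> H) (e_onb : orthonormal_basis e)
    (T : Omega -> {linear H -> H})
    (T_shift : forall w, unilateral_shift e (fun n => X n w) (T w))
    (K : hilbertType R) (f : int -> K) (f_onb : orthonormal_basis f)
    (lambda : int -> R) (lambda_ge0 : forall i, 0 <= lambda i)
    (A : {linear K -> K}) (A_shift : bilateral_shift f lambda A) :
  let Gamma := essran (X 0%N) in
  let Gamma1 := Gamma `\ 0 in
  let Sigma := n_spectrum lambda in
  [/\ [/\ measurable [set w | A ◁ T w],
          Sigma 1%N `<=` cartesian_power Gamma 1 ->
            P [set w | A ◁ T w] = 1%E &
          ~ (Sigma 1%N `<=` cartesian_power Gamma 1) ->
            P [set w | A ◁ T w] = 0%E],
      ~ Gamma 0 ->
        ({ae P, forall w, T w ◁ A} <->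
         forall n, (1 <= n)%N ->
           [set row_mx (0 : 'rV[R]_1) u | u in cartesian_power Gamma n]
             `<=` Sigma (1 + n)%N),
      limit_point Gamma 0 ->
        ({ae P, forall w, T w ◁ A} <->
         forall n, (1 <= n)%N -> cartesian_power Gamma n `<=` Sigma n) &
      isolated Gamma 0 ->
        ({ae P, forall w, T w ◁ A} <->
         forall n,
           [set row_mx (row_mx (0 : 'rV[R]_1) u) (0 : 'rV[R]_1)
             | u in cartesian_power Gamma1 n]
             `<=` Sigma (1 + n + 1)%N)].
Proof.
move=> Gamma Gamma1 Sigma.
have mE := measurable_lhd_random X_ge0 e_onb T_shift f_onb lambda_ge0 A_shift.
have sub1 := spectrum1_subset (X := X) lambda_ge0.
split.
- split=> // [/sub1 Gl|nsub].
    have := ae_lhd_random X_ge0 X_iid e_onb T_shift f_onb lambda_ge0 A_shift Gl.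
    rewrite /prop_near1 /almost_everywhere /= => /negligibleP h.
    have := probability_setC P (measurableC mE); rewrite setCK h ?sube0 //.
    exact: measurableC.
  have [i Gi] : exists i, ~ Gamma (lambda i).
    apply: contrapT => h; apply/nsub/sub1 => i; apply: contrapT => Gi.
    by apply: h; exists i.
  apply/negligibleP => //; apply: negligibleS (ae_essran X_iid) => w /= AT GX.
  exact: (not_lhd_random X_ge0 e_onb T_shift f_onb lambda_ge0 A_shift Gi GX AT).
- exact: (random_lhd_invertible X_ge0 X_iid e_onb T_shift f_onb
    lambda_ge0 A_shift).
- exact: (random_lhd_accumulation X_ge0 X_iid e_onb T_shift f_onb
    lambda_ge0 A_shift).
- exact: (random_lhd_isolated X_ge0 X_iid e_onb T_shift f_onb
    lambda_ge0 A_shift).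
Qed.
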